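(* Let $M$ be a matroid whose base polytope $P=B(M)$ is 2-level, and let $d$ be the dimension of $P$. Then $f_0(P)f_{d-1}(P)\leq d2^{d+1}$, and equality holds if and only if $P$ is affinely isomorphic to the $d$-dimensional cube or the $d$-dimensional cross-polytope.
   Context: For a $d$-dimensional polytope $P$, $f_0(P)$ is its number of vertices and $f_{d-1}(P)$ its number of facets. Convention for $d=0$: a point has no facets, so the product is $0$, and the $0$-dimensional cube and cross-polytope are points. A polytope $P$ is 2-level if for each facet $F$ of $P$ all vertices of $P$ not in $F$ lie in one common translate of the affine hull of $F$. The $d$-dimensional cube is $[-1,1]^d$ and the $d$-dimensional cross-polytope is its polar. The base polytope $B(M)\subseteq\mathbb{R}^E$ of a matroid $M$ with ground set $E$ is the convex hull of the characteristic vectors of its bases. *)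

(* Defs.v *)
From HB Require Import structures.
From mathcomp Require Import all_boot all_order all_algebra finmap.
From mathcomp Require Import boolp classical_sets functions cardinality reals.
Set Implicit Arguments.
Unset Strict Implicit.
Unset Printing Implicit Defensive.
Import Order.TTheory GRing.Theory Num.Theory.
Local Open Scope classical_set_scope.
Local Open Scope ring_scope.

Record matroid (E : finType) := Matroid {
  bases : {set {set E}};
  bases_neq0 : bases != finset.set0;
  bases_exchange : forall B1 B2 : {set E}, B1 \in bases -> B2 \in bases ->
    forall x, x \in B1 :\: B2 ->
    exists2 y, y \in B2 :\: B1 & y |: (B1 :\ x) \in bases }.

Section Polytope.
Context {R : realType} {V : vectType R}.
Implicit Types (S P F : set V).

Definition conv_hull S : set V :=
  [set y | exists (n : nat) (a : 'I_n -> R) (x : 'I_n -> V),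
    [/\ forall i, S (x i), forall i, 0 <= a i, \sum_i a i = 1 &
        y = \sum_i a i *: x i]].

Definition aff_hull S : set V :=
  [set y | exists (n : nat) (a : 'I_n -> R) (x : 'I_n -> V),
    [/\ forall i, S (x i), \sum_i a i = 1 & y = \sum_i a i *: x i]].

(* The linear subspace U such that aff_hull S = x + U for some x; it is unique
   when S is nonempty, and it defaults to 0 when S is empty. *)
Definition aff_direction S : {vspace V} :=
  xget 0%VS [set U : {vspace V} |
    exists x : V, aff_hull S = [set x + u | u in [set u | u \in U]]].

Definition aff_dim S : nat := \dim (aff_direction S).

(* F is the intersection of P with a supporting hyperplane; the trivial faces
   P and set0 are included. *)
Definition face P F : Prop :=
  exists (f : {linear V -> R^o}) (c : R),
    (forall x, P x -> f x <= c) /\ F = [set x | P x /\ f x = c].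

Definition vertices P : set V := [set x | face P [set x]].

(* Facets are nonempty by definition, so that a point has no facets. *)
Definition facets P : set (set V) :=
  [set F | [/\ face P F, F !=set0 & (aff_dim F).+1 = aff_dim P]].

(* fset_set is the empty set on infinite sets, but a polytope has finitely many
   vertices and facets. *)
Definition num_vertices P : nat := #|` fset_set (vertices P)|.

Definition num_facets P : nat := #|` fset_set (facets P)|.

Definition two_level P : Prop :=
  forall F, facets P F -> exists v : V,
    vertices P `\` F `<=` [set y + v | y in aff_hull F].

End Polytope.

(* The affine map need not be injective outside of P. *)
Definition aff_isomorphic (R : realType) (V W : vectType R)
    (P : set V) (Q : set W) : Prop :=
  exists (f : {linear V -> W}) (b : W), set_bij P Q (fun x => f x + b).

Definition cube (R : realType) (d : nat) : set 'rV[R]_d :=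
  [set x | forall i, -1 <= x 0 i <= 1].
Arguments cube : clear implicits.

Definition polar (R : realType) (d : nat) (P : set 'rV[R]_d) : set 'rV[R]_d :=
  [set y | forall x, P x -> \sum_i x 0 i * y 0 i <= 1].

Definition cross_polytope (R : realType) (d : nat) : set 'rV[R]_d :=
  polar (cube R d).
Arguments cross_polytope : clear implicits.

Definition char_vec (R : realType) (E : finType) (B : {set E}) :
    {ffun E -> R^o} := [ffun e => (e \in B)%:R].
Arguments char_vec R {E} B.

Definition base_polytope (R : realType) (E : finType) (M : matroid E) :
    set {ffun E -> R^o} :=
  conv_hull [set char_vec R B | B in [set B | B \in bases M]].
Arguments base_polytope R {E} M.

(* Main.v *)
From HB Require Import structures.
Require Import Defs.
From mathcomp Require Import all_boot all_order all_algebra finmap.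
From mathcomp Require Import boolp classical_sets functions cardinality reals.
From mathcomp Require Import zify ring lra.
Set Implicit Arguments.
Unset Strict Implicit.
Unset Printing Implicit Defensive.
Import Order.TTheory GRing.Theory Num.Theory.

(** A 2-level base polytope is cut out by few facets, and it is small enough
    for a count over the connected components of the matroid.

    Facets.  Let F be the face of P on which a weight function is maximal.
    A base of maximal weight meets every upper level set T of the weights in
    as many elements as possible, because otherwise an exchange into T
    improves it (rank_improve).  So F satisfies x(T) = r(T) for each level
    set, and if F is a facet, one non-separating level set, cut down to one
    component C, describes F already: F is given by x(A) = r(A) for some
    A inside C (facet_is_flacet).  Since dim F = dim P - 1, no other
    functional may become constant on F, which says that A cannot be split
    additively, and neither can the part of C outside A after contracting A.
    The 2-level property bounds |B :&: A| from below by r(A) - 1, that is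
    r(A) + r(C - A) = r(C) + 1.  Such sets A are called flacets below.

    Counting facets.  Submodularity shows that flacets do not cross
    (flacet_noncrossing), and that A and C - A are not both flacets if A is
    the union of two disjoint sets that satisfy the rank equation
    (flacet_pair_no_tripartition).  A laminar family with this restriction has
    at most 3 |C| - 4 members when |C| > 1 (card_flacets_le).

    Counting vertices.  A base meets C in r(C) elements, so there are at most
    as many bases as the product of the binomial coefficients
    'C(|C|, r(C)).  For a component of size n one has 'C(n, k) <= 2 ^ (n - 1)
    and 'C(n, k) (3 n - 4) <= (n - 1) 2 ^ n (bin_facet_bound).  As dim P is
    the sum of the numbers |C| - 1, multiplying out over the components gives
    the bound (prod_sum_le).

    Equality.  If all components have at most two elements, equality forces
    2 ^ d bases, and P projects isomorphically onto a cube.  Otherwise some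
    component C has at least three elements; then 'C(|C|, k) < 2 ^ (|C| - 1)
    forces all other components to be singletons, and the binomial inequality
    is tight only for |C| = 4 and r(C) = 2.  All six 2-subsets of C then occur,
    and P is an octahedron.  Conversely the faces of the cube and of the
    cross-polytope are computed, and affine isomorphisms preserve their
    numbers. *)

(** * Matroid rank, separators and components *)

Section Exchange.
Import mathcomp.boot.fintype mathcomp.boot.finset.
Context {E : finType} (M : matroid E).
Implicit Types (A B S T : {set E}) (x y : E).

(** Exchanges lead from any base to any other one, each step removing an element
    outside the target.  Constancy on all bases can thus be checked on a single
    exchange. *)
Lemma exchange_invariant (W : Type) (h : {set E} -> W) :
  (forall B x y, B \in bases M -> x \in B -> y \notin B ->
     y |: (B :\ x) \in bases M -> h (y |: (B :\ x)) = h B) ->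
  forall B1 B2, B1 \in bases M -> B2 \in bases M -> h B1 = h B2.
Proof.
move=> h_inv B1 B2; have [m] := ubnP #|B1 :\: B2|.
elim: m B1 => // m IHm B1 ltm B1M B2M.
have [sB12|/subsetPn[x xB1 xB2]] := boolP (B1 \subset B2).
  case: (eqVneq B1 B2) => [-> //|neqB].
  have /properP[_ [z zB2 zB1]] : B1 \proper B2 by rewrite properEneq neqB.
  have zD : z \in B2 :\: B1 by rewrite inE zB1.
  have [y] := bases_exchange B2M B1M zD.
  by rewrite inE => /andP[/negP yB2 /(subsetP sB12)].
have xD : x \in B1 :\: B2 by rewrite inE xB2.
have [y /setDP[yB2 yB1] B1'M] := bases_exchange B1M B2M xD.
rewrite -(h_inv _ _ _ B1M xB1 yB1 B1'M); apply: IHm => //.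
rewrite ltnS in ltm; apply: leq_trans ltm; apply: proper_card.
apply/properP; split.
  apply/subsetP => z; rewrite !inE => /andP[zB2 /orP[/eqP zy|/andP[_ ->]]].
    by rewrite zy yB2 in zB2.
  by rewrite zB2.
by exists x => //; rewrite !inE eqxx xB2 /= orbF; apply: contraNneq yB1 => <-.
Qed.

(** Written with the membership bits on both sides to avoid truncated
    subtraction. *)
Lemma card_exchange T B x y : x \in B -> y \notin B ->
  #|T :&: (y |: (B :\ x))| + (x \in T) = #|T :&: B| + (y \in T).
Proof.
move=> xB yB; have ny : y \notin T :&: (B :\ x) by rewrite !inE (negPf yB) !andbF.
have -> : #|T :&: (y |: (B :\ x))| = #|T :&: (B :\ x)| + (y \in T).
  rewrite setIUr; case: (boolP (y \in T)) => yT.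
    by rewrite (setIidPr _) ?sub1set// cardsU1 ny addnC.
  have -> : T :&: [set y] = set0 by apply/eqP; rewrite setI_eq0 disjoint_sym disjoints1.
  by rewrite set0U addn0.
have -> : #|T :&: B| = #|T :&: (B :\ x)| + (x \in T).
  rewrite (cardsD1 x) !inE xB andbT addnC; congr (_ + _).
  by apply: eq_card => z; rewrite !inE; do !case: (_ \in _); case: (_ == _).
by rewrite -!addnA; congr (_ + _); rewrite addnC.
Qed.

Lemma card_basis B1 B2 : B1 \in bases M -> B2 \in bases M -> #|B1| = #|B2|.
Proof.
apply: (@exchange_invariant nat (fun B : {set E} => #|B|)) => B x y _ xB yB _.
by have := card_exchange setT xB yB; rewrite !setTI !inE => /addIn.
Qed.

Definition rank A := \max_(B in bases M) #|A :&: B|.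

Lemma rank_ge A B : B \in bases M -> #|A :&: B| <= rank A.
Proof. by move=> BM; apply: (@leq_bigmax_cond _ (mem (bases M)) (fun B => #|A :&: B|)). Qed.

Lemma rank_attained A : exists2 B, B \in bases M & #|A :&: B| = rank A.
Proof.
have [|B BM eB] := @eq_bigmax_cond _ (mem (bases M)) (fun B => #|A :&: B|).
  by rewrite card_gt0 bases_neq0.
by exists B => //; rewrite -eB.
Qed.

(** The greedy principle: local optimality for T is global.  Among the bases that
    meet T in more elements than B, one that is closest to B differs from B only
    by elements of T; an exchange from B towards it brings in an element of T. *)
Lemma rank_improve T B : B \in bases M -> #|T :&: B| < rank T ->
  exists x y, [/\ x \in B :\: T, y \in T :\: B & y |: (B :\ x) \in bases M].
Proof.
move=> BM ltT.
pose Q B' := (B' \in bases M) && (#|T :&: B| < #|T :&: B'|).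
have [B0 B0M B0T] := rank_attained T.
have QB0 : Q B0 by rewrite /Q B0M B0T.
case: (arg_minnP (fun B' => #|B' :\: B|) QB0) => B' /andP[B'M ltB'] minB'.
have sT : B' :\: B \subset T.
  apply/subsetP => x xD; apply/negPn/negP => xT.
  have [y /setDP[yB yB'] B2M] := bases_exchange B'M BM xD.
  have /setDP[xB' xB] := xD.
  have := card_exchange T xB' yB'; rewrite (negPf xT) addn0 => cT.
  have QB2 : Q (y |: (B' :\ x)) by rewrite /Q B2M cT ltn_addr.
  have := minB' _ QB2; rewrite leqNgt => /negP; apply; apply: proper_card.
  apply/properP; split.
    by apply/subsetP => z; rewrite !inE; case: (eqVneq z y) => [->|_] /=;
      rewrite ?yB //; case: (z \in B) => //=; case/andP.
  exists x => //; rewrite !inE eqxx /= orbF (negPf xB) /=.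
  by apply: contraNneq yB' => <-.
have [x xB] : exists2 x, x \in B :\: B' & x \notin T.
  apply/exists_inP; rewrite -negb_forall_in; apply/negP => /forall_inP sT'.
  move: ltB'; rewrite ltnNge => /negP; apply.
  have cBB : #|B :\: B'| = #|B' :\: B|.
    by have := cardsID B' B; have := cardsID B B'; rewrite setIC (card_basis BM B'M); lia.
  have cBT A1 A2 : A1 :\: A2 \subset T -> #|T :&: A1| = #|T :&: (A1 :&: A2)| + #|A1 :\: A2|.
    move=> s; rewrite -(cardsID A2 (T :&: A1)) setIA; congr (_ + _).
    by apply: eq_card => z; rewrite !inE; have := subsetP s z; rewrite !inE;
      do !case: (_ \in _) => //=; move/(_ isT).
  rewrite (cBT _ _ sT) (cBT B B'); last first.
    by apply/subsetP => z /sT'.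
  by rewrite (setIC B) cBB.
move=> xT; have [y yD B2M] := bases_exchange BM B'M xB.
exists x, y; split=> //; first by move: xB; rewrite !inE xT => /andP[_ ->].
by have /setDP[yB' yB] := yD; rewrite inE yB (subsetP sT).
Qed.

Lemma rank_mono A1 A2 : A1 \subset A2 -> rank A1 <= rank A2.
Proof.
move=> sA; have [B BM <-] := rank_attained A1.
by apply: leq_trans (rank_ge A2 BM); apply/subset_leq_card/setSI.
Qed.

Lemma rank_le_card A : rank A <= #|A|.
Proof. by have [B _ <-] := rank_attained A; apply/subset_leq_card/subsetIl. Qed.

Lemma cardIC A B : B \in bases M -> #|A :&: B| + #|~: A :&: B| = rank setT.
Proof.
move=> BM; have [B0 B0M <-] := rank_attained setT.
by rewrite setTI -(card_basis BM B0M) -(cardsID A B) setIC setDE (setIC B (~: A)).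
Qed.

(** By the greedy principle, a base that maximises the sum of its traces on the
    nested pair A1 :&: A2, A1 :|: A2 attains both ranks at once. *)
Lemma rank_submod A1 A2 : rank (A1 :|: A2) + rank (A1 :&: A2) <= rank A1 + rank A2.
Proof.
have [B0 B0M _] := rank_attained setT.
pose h B := #|(A1 :&: A2) :&: B| + #|(A1 :|: A2) :&: B|.
case: (arg_maxnP h B0M) => B BM maxB.
have opt T : (forall x y, x \in B :\: T -> y \in T :\: B -> y |: (B :\ x) \in bases M ->
    h B < h (y |: (B :\ x))) -> rank T = #|T :&: B|.
  move=> impr; apply/eqP; rewrite eqn_leq rank_ge // andbT leqNgt; apply/negP.
  move=> /(rank_improve BM)[x [y [xD yD B'M]]].
  by have := maxB _ B'M; rewrite /= leqNgt impr.
rewrite (opt (A1 :|: A2)) ?(opt (A1 :&: A2)).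
- have := cardsUI (A1 :&: B) (A2 :&: B).
  rewrite -setIUl setIACA setIid => ->.
  by rewrite leq_add // rank_ge.
- move=> x y /setDP[xB xT] /setDP[yT yB] _.
  have := card_exchange (A1 :&: A2) xB yB; have := card_exchange (A1 :|: A2) xB yB.
  by rewrite /h; move: xT yT; rewrite !inE; do !case: (_ \in _) => //=; lia.
move=> x y /setDP[xB xT] /setDP[yT yB] _.
have := card_exchange (A1 :&: A2) xB yB; have := card_exchange (A1 :|: A2) xB yB.
by rewrite /h; move: xT yT; rewrite !inE; do !case: (_ \in _) => //=; lia.
Qed.

Lemma rank0 : rank set0 = 0.
Proof. by apply/eqP; rewrite -leqn0 -(cards0 E) rank_le_card. Qed.

Definition separator S := rank S + rank (~: S) == rank setT.

Lemma rank_setC_ge S : rank setT <= rank S + rank (~: S).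
Proof. by have := rank_submod S (~: S); rewrite setUCr setICr rank0 addn0. Qed.

Lemma separator_card S B : separator S -> B \in bases M -> #|S :&: B| = rank S.
Proof.
move=> /eqP sS BM; have := cardIC S BM; have := rank_ge S BM; have := rank_ge (~: S) BM; lia.
Qed.

Lemma separatorP S : (forall B1 B2, B1 \in bases M -> B2 \in bases M ->
  #|S :&: B1| = #|S :&: B2|) -> separator S.
Proof.
move=> cS; have [B1 B1M r1] := rank_attained S; have [B2 B2M r2] := rank_attained (~: S).
by rewrite /separator -r1 -r2 (cS _ _ B1M B2M) cardIC.
Qed.

Lemma separatorC S : separator (~: S) = separator S.
Proof. by rewrite /separator setCK addnC. Qed.

Lemma separatorI S1 S2 : separator S1 -> separator S2 -> separator (S1 :&: S2).
Proof.
rewrite /separator => /eqP s1 /eqP s2.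
have := rank_submod S1 S2; have := rank_submod (~: S1) (~: S2).
rewrite -setCI -setCU; have := rank_setC_ge (S1 :&: S2); have := rank_setC_ge (S1 :|: S2).
by lia.
Qed.

(** Two applications of submodularity, to A and S and then to A :|: S and ~: S,
    add up to the nontrivial inequality. *)
Lemma rank_separator S A : separator S -> rank A = rank (A :&: S) + rank (A :\: S).
Proof.
move=> /eqP sS; have := rank_submod (A :&: S) (A :\: S).
have := rank_submod A S; have := rank_submod (A :|: S) (~: S).
rewrite -setUA setUCr setUT setIUl setICr setU0 -setDE.
have -> : (A :&: S) :|: (A :\: S) = A by rewrite setID.
by lia.
Qed.

(** Components are the atoms of the Boolean algebra of separators.  This avoids
    circuits, and the proof that lying on a common circuit is transitive. *)
Definition same_component x y := [forall S, separator S ==> ((x \in S) == (y \in S))].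

Definition components := equivalence_partition same_component setT.

Lemma same_component_equiv : {in setT & &, equivalence_rel same_component}.
Proof.
move=> x y z _ _ _; split; first by apply/forallP=> S; rewrite eqxx implybT.
move=> /forallP xy; apply: eq_forallb => S; apply: implyb_id2l => sS.
by have /implyP/(_ sS)/eqP -> := xy S.
Qed.

Lemma components_partition : partition components setT.
Proof. exact/equivalence_partitionP/same_component_equiv. Qed.

Lemma componentP C x y : C \in components -> x \in C -> (y \in C) = same_component x y.
Proof.
move=> CP xC; have /and3P[_ tP _] := components_partition.
rewrite -(pblock_equivalence_partition same_component_equiv) ?inE //.
by rewrite -/components (def_pblock tP CP xC).
Qed.

Lemma component_neq0 C : C \in components -> C != set0.
Proof. by have /and3P[_ _ n0] := components_partition; apply: contraTneq => ->. Qed.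

Lemma component_separator C : C \in components -> separator C.
Proof.
move=> CP; have /set0Pn[x xC] := component_neq0 CP.
have -> : C = \bigcap_(S | separator S && (x \in S)) S.
  apply/setP => y; rewrite (componentP _ CP xC).
  apply/forallP/bigcapP => [H S /andP[sS xS]|H S].
    by have := H S; rewrite sS xS => /eqP <-.
  apply/implyP => sS; case: (boolP (x \in S)) => xS; first by rewrite H // sS.
  have := H (~: S); rewrite separatorC sS inE xS => /(_ isT).
  by rewrite inE => /negPf ->.
apply: (big_ind (fun S => separator S)) => [|S T|S /andP[] //]; last exact: separatorI.
by rewrite /separator setCT rank0 addn0.
Qed.

Lemma component_atom C S x y : C \in components -> separator S ->
  x \in C -> y \in C -> (x \in S) = (y \in S).
Proof.
by move=> CP sS xC; rewrite (componentP _ CP xC) => /forallP/(_ S)/implyP/(_ sS)/eqP.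
Qed.

Lemma component_connected C A : C \in components -> A != set0 -> A \proper C ->
  rank C < rank A + rank (C :\: A).
Proof.
move=> CP /set0Pn[x xA] /properP[sAC [y yC yA]].
rewrite ltnNge; apply/negP => le_r.
have sC := component_separator CP.
have sA : separator A.
  have := rank_separator (~: A) sC; have := rank_separator setT sC.
  rewrite setTI setTD (setIC (~: A)) -setDE [~: A :\: C]setDE -setCU (setUidPr sAC).
  by have := rank_setC_ge A; rewrite /separator => ? ? ?; apply/eqP; lia.
by have := component_atom CP sA (subsetP sAC _ xA) yC; rewrite xA (negPf yA).
Qed.

(** The level sets of such a function are separators. *)
Lemma exchange_constant_component (W : eqType) (w : E -> W) C :
  (forall B x y, B \in bases M -> x \in B -> y \notin B ->
     y |: (B :\ x) \in bases M -> w x = w y) ->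
  C \in components -> {in C &, forall x y, w x = w y}.
Proof.
move=> w_inv CP x y xC yC; pose S := [set z | w z == w x].
have sS : separator S.
  apply: separatorP.
  apply: (@exchange_invariant nat (fun B => #|S :&: B|)) => B a b BM aB bB B'M.
  by have := card_exchange S aB bB; rewrite !inE (w_inv _ _ _ BM aB bB B'M) => /addIn.
by have := component_atom CP sS xC yC; rewrite !inE eqxx => /esym/eqP ->.
Qed.

End Exchange.

(** * Counting flacets *)
(** The rank function enters only through submodularity, monotonicity, the value
    on singletons, and the connectedness of C. *)
Section Flacets.
Import mathcomp.boot.fintype mathcomp.boot.finset.
Context {E : finType} (r : {set E} -> nat) (C : {set E}).
Implicit Types (A L S U Y : {set E}).
Hypothesis r_submod : forall A1 A2, r (A1 :|: A2) + r (A1 :&: A2) <= r A1 + r A2.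
Hypothesis r_mono : forall A1 A2, A1 \subset A2 -> r A1 <= r A2.
Hypothesis r_set1 : forall x, r [set x] <= 1.
Hypothesis connected_C : forall A, A != set0 -> A \proper C -> r C < r A + r (C :\: A).

(** The connectivity function r A + r (C :\: A) - r C takes its smallest possible
    value, 1, on these sets; the 2-level property puts facets among them. *)
Definition two_separation A :=
  [&& A != set0, A \proper C & r A + r (C :\: A) == (r C).+1].

(** The last two conditions say that the restriction to A and the contraction of
    A are connected: in the contraction, Y and (C :\: A) :\: Y have the ranks
    r (A :|: Y) - r A and r (C :\: Y) - r A. *)
Definition flacet A := [&& two_separation A,
  [forall U : {set E}, (U != set0) && (U \proper A) ==> (r A < r U + r (A :\: U))] &
  [forall Y : {set E}, (Y != set0) && (Y \proper C :\: A) ==>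
     (r C + r A < r (A :|: Y) + r (C :\: Y))]].

Definition flacets := [set A | flacet A].

(** Suppose that A and L cross.  Uncrossing the pairs A, L and A, C :\: L and
    their complements shows that all four quadrants have connectivity 1, and that
    submodularity is tight.  The tight values contradict the sum of the two
    connectedness conditions on A, tested on A :&: L and on L :\: A. *)
Lemma flacet_noncrossing A L : flacet A -> two_separation L ->
  [|| A :&: L == set0, A \subset L, L \subset A | A :|: L == C].
Proof.
move=> /and3P[/and3P[_ /andP[sA _] /eqP eA] /forallP hU /forallP hY].
move=> /and3P[_ /andP[sL _] /eqP eL].
apply/negPn/negP; rewrite !negb_or => /and4P[nI nAL nLA nU].
have xC (x : E) : ((x \in A) ==> (x \in C)) && ((x \in L) ==> (x \in C)).
  by apply/andP; split; apply/implyP; [exact: (subsetP sA) | exact: (subsetP sL)].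
have sU : A :|: L \subset C by rewrite subUset sA.
have pU : A :|: L \proper C by rewrite properEneq nU.
have hsub (X Y : {set E}) : X \subset Y -> Y \proper C -> X \proper C.
  exact: sub_proper_trans.
have {}nAL : A :\: L != set0 by rewrite setD_eq0.
have {}nLA : L :\: A != set0 by rewrite setD_eq0.
have c1 := connected_C nI (hsub _ _ (subset_trans (subsetIl A L) (subsetUl A L)) pU).
have c2 := connected_C nAL (hsub _ _ (subset_trans (subsetDl A L) (subsetUl A L)) pU).
have c3 := connected_C nLA (hsub _ _ (subset_trans (subsetDl L A) (subsetUr A L)) pU).
have nU0 : A :|: L != set0.
  by apply: contraNneq nI => /eqP; rewrite setU_eq0 => /andP[/eqP -> _]; rewrite set0I.
have c4 := connected_C nU0 pU.
have s1 := r_submod A L.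
have := r_submod (C :\: A) (C :\: L).
have -> : (C :\: A) :|: (C :\: L) = C :\: (A :&: L) by rewrite setDIr.
have -> : (C :\: A) :&: (C :\: L) = C :\: (A :|: L) by rewrite setDUr.
have := r_submod A (C :\: L).
have -> : A :|: (C :\: L) = C :\: (L :\: A).
  by apply/setP => x; rewrite !inE; have := xC x; do !case: (x \in _).
have -> : A :&: (C :\: L) = A :\: L.
  by apply/setP => x; rewrite !inE; have := xC x; do !case: (x \in _).
have := r_submod (C :\: A) L.
have -> : (C :\: A) :|: L = C :\: (A :\: L).
  by apply/setP => x; rewrite !inE; have := xC x; do !case: (x \in _).
have -> : (C :\: A) :&: L = L :\: A.
  by apply/setP => x; rewrite !inE; have := xC x; do !case: (x \in _).
have := hU (A :&: L); rewrite nI /=.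
have -> : A :&: L \proper A.
  by rewrite properE subsetIl subsetI subxx /= -setD_eq0.
have -> : A :\: (A :&: L) = A :\: L by rewrite setDIr setDv set0U.
move=> /= u1.
have := hY (L :\: A); rewrite nLA /=.
have -> : L :\: A \proper C :\: A.
  rewrite properE setSD //=; apply: contra nU => /subsetP s.
  rewrite eqEsubset sU /=; apply/subsetP => x xCx; rewrite inE.
  by have := s x; rewrite !inE xCx; case: (x \in A) => //= /(_ isT).
have -> : A :|: (L :\: A) = A :|: L by apply/setP => x; rewrite !inE; do !case: (x \in _).
move=> /= u2; lia.
Qed.

Lemma two_separationC A : A \subset C -> two_separation (C :\: A) = two_separation A.
Proof.
move=> sA; rewrite /two_separation setDDr setDv set0U (setIidPr sA) addnC.
rewrite setD_eq0 !properE sA subsetDl /= andbCA; congr [&& _, _ & _].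
by rewrite subsetD subxx /= -setI_eq0 (setIidPr sA).
Qed.

Lemma flacet_two_separation A : flacet A -> two_separation A.
Proof. by case/and3P. Qed.

(** With x, y, z the ranks of C :\: S, L and S :\: L, the contraction of C :\: S
    being connected gives x + y + z <= r C + 1, and the restriction to S being
    connected gives x + y + z >= r C + 2. *)
Lemma flacet_pair_no_tripartition S L : flacet S -> flacet (C :\: S) -> L \proper S ->
  two_separation L -> two_separation (S :\: L) -> False.
Proof.
move=> /and3P[/and3P[_ /andP[sS _] /eqP eS] /forallP hU _].
move=> /and3P[_ _ /forallP hY] pL.
have sL := proper_sub pL.
move=> /and3P[L0 _ /eqP eL] /and3P[SL0 _ /eqP eSL].
have := hU L; rewrite L0 pL /=.
have := hY L; rewrite L0 setDDr setDv set0U (setIidPr sS) pL /=.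
have -> : (C :\: S) :|: L = C :\: (S :\: L); last by lia.
by rewrite setDDr (setIidPr (subset_trans sL sS)).
Qed.

(** A flacet is identified with its complement here, so that the family is
    laminar once a fixed point x0 of C is kept outside S. *)
Definition flacets_within S := [set A | flacet A & (A \subset S) || (C :\: A \subset S)].

Definition num_flacet_sides S : nat := flacet S + flacet (C :\: S).

Lemma set1_two_separation x : x \in C -> 1 < #|C| -> two_separation [set x].
Proof.
move=> xC C1; have sx : [set x] \subset C by rewrite sub1set.
have x0 : [set x] != set0 by rewrite -cards_eq0 cards1.
have px : [set x] \proper C by rewrite properEcard sx cards1.
rewrite /two_separation x0 px /= eqn_leq.
rewrite (connected_C x0 px) andbT -addn1 addnC.
by rewrite leq_add // ?r_set1 // r_mono // subsetDl.
Qed.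

(** Induction on S.  Let L be a largest proper subset of S that is a singleton or
    a side of a flacet.  By non-crossing, each flacet with a side properly inside
    S has this side in L or in S :\: L.  The bonus (0 < num_flacet_sides S) keeps
    the induction tight: when S contributes two flacets, S :\: L is not a side of
    one, by flacet_pair_no_tripartition, and its bonus is saved. *)
Lemma card_flacets_within_le S x0 : 1 < #|C| -> x0 \in C -> S \subset C :\ x0 -> S != set0 ->
  #|flacets_within S| <= 3 * #|S| - 2 + (0 < num_flacet_sides S).
Proof.
move=> C1 x0C; have [m] := ubnP #|S|; elim: m S => // m IHm S ltm sS nS.
have sSC : S \subset C := subset_trans sS (subsetDl _ _).
have x0S : x0 \notin S by apply/negP => /(subsetP sS); rewrite !inE eqxx.
have split_top : flacets_within S \subset
   [set A in flacets_within S | (A != S) && (C :\: A != S)] :|: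
   [set A | flacet A & (A == S) || (A == C :\: S)].
  apply/subsetP => A; rewrite !inE => /andP[fA ->]; rewrite fA /=.
  case: (eqVneq A S) => //= _; case: (eqVneq (C :\: A) S) => //= <-.
  have /and3P[/and3P[_ /andP[sA _] _] _ _] := fA.
  by rewrite setDDr setDv set0U (setIidPr sA) eqxx.
have card_top : #|[set A | flacet A & (A == S) || (A == C :\: S)]| <= num_flacet_sides S.
  have -> : [set A | flacet A & (A == S) || (A == C :\: S)] =
     [set A in [set S] | flacet A] :|: [set A in [set C :\: S] | flacet A].
    by apply/setP => A; rewrite !inE; case: (flacet A); rewrite ?andbF ?andbT.
  apply: leq_trans (leq_card_setU _ _) _; apply: leq_add.
    have -> : [set A in [set S] | flacet A] = if flacet S then [set S] else set0.
      apply/setP => A; rewrite !inE; case: (eqVneq A S) => [->|nA] /=;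
      by case: ifP; rewrite !inE ?eqxx // (negPf nA).
    by case: ifP; rewrite ?cards1 ?cards0.
  have -> : [set A in [set C :\: S] | flacet A] =
      if flacet (C :\: S) then [set C :\: S] else set0.
    apply/setP => A; rewrite !inE; case: (eqVneq A (C :\: S)) => [->|nA] /=;
    by case: ifP; rewrite !inE ?eqxx // (negPf nA).
  by case: ifP; rewrite ?cards1 ?cards0.
have le_top := leq_trans (subset_leq_card split_top) (leq_card_setU _ _).
have [S1|S1] := leqP #|S| 1.
  have S1' : #|S| = 1 by apply/eqP; rewrite eqn_leq S1 card_gt0.
  have e0 : [set A in flacets_within S | (A != S) && (C :\: A != S)] = set0.
    apply/setP => A; rewrite !inE; apply/negbTE/negP => /andP[/andP[fA sAS] /andP[nA nCA]].
    have /cards1P[x eS] : #|S| == 1 by rewrite S1'.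
    have /and3P[A0 pA _] := flacet_two_separation fA.
    case/orP: sAS; rewrite eS subset1 -eS ?(negPf nA) ?(negPf nCA) /=.
      by rewrite (negPf A0).
    by rewrite setD_eq0; move: pA; rewrite properE => /andP[_ /negPf ->].
  move: le_top; rewrite e0 cards0 add0n S1' /= => le_top.
  apply: leq_trans le_top _; apply: leq_trans card_top _.
  by rewrite /num_flacet_sides; do 2 case: flacet.
pose good L := [&& L \proper S, L != set0 & (0 < num_flacet_sides L) || (#|L| == 1)].
have /set0Pn[x xS] := nS.
have good1 : good [set x].
  by rewrite /good properEcard sub1set xS cards1 S1 -cards_eq0 cards1 eqxx orbT.
case: (arg_maxnP (fun L => #|L|) good1) => L /and3P[pL L0 gL] maxL.
have sL := proper_sub pL.
have tL : two_separation L.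
  case/orP: gL => [|/cards1P[y eL]]; last first.
    by rewrite eL set1_two_separation // -sub1set -eL (subset_trans sL).
  rewrite /num_flacet_sides addn_gt0 !lt0b => /orP[/flacet_two_separation //|].
  by move=> /flacet_two_separation; rewrite two_separationC // (subset_trans sL).
have sub : [set A in flacets_within S | (A != S) && (C :\: A != S)] \subset
    flacets_within L :|: flacets_within (S :\: L).
  apply/subsetP => A; rewrite !inE => /andP[/andP[fA sAS] /andP[nA nCA]]; rewrite fA /=.
  have /and3P[A0 pA _] := flacet_two_separation fA.
  have sA := proper_sub pA.
  have x0L : x0 \notin L by apply: contra x0S; apply: (subsetP sL).
  have cross := flacet_noncrossing fA tL.
  have CA0 : C :\: A != set0 by rewrite setD_eq0; move: pA; rewrite properE => /andP[].
  have maxA (K : {set E}) : K \subset S -> K != S -> K != set0 ->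
      0 < num_flacet_sides K -> L \subset K -> K = L.
    move=> sK nK K0 wK sLK; apply/esym/eqP; rewrite eqEcard sLK /=.
    by apply: maxL; rewrite /good properEneq nK sK K0 wK.
  case/orP: sAS => sAS.
    case/or4P: cross => cross.
    - by rewrite [A \subset S :\: L]subsetD sAS -setI_eq0 cross !orbT.
    - by rewrite cross.
    - rewrite (maxA A sAS nA A0 _ cross) ?subxx //.
      by rewrite /num_flacet_sides fA.
    - have : x0 \in A :|: L by rewrite (eqP cross).
      by rewrite inE (negPf x0L) orbF => /(subsetP sAS); rewrite (negPf x0S).
  have xC y : (y \in A) ==> (y \in C) by apply/implyP; exact: (subsetP sA).
  case/or4P: cross => cross.
  - have sLCA : L \subset C :\: A.
      by rewrite subsetD (subset_trans sL sSC) -setI_eq0 setIC cross.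
    rewrite (maxA _ sAS nCA CA0 _ sLCA) ?subxx ?orbT //.
    by rewrite /num_flacet_sides setDDr setDv set0U (setIidPr sA) fA addn1.
  - have : x0 \notin C :\: A by apply: contra x0S; apply: (subsetP sAS).
    rewrite inE x0C andbT negbK => x0A.
    by rewrite (subsetP cross _ x0A) in x0L.
  - have -> : C :\: A \subset S :\: L; last by rewrite !orbT.
    rewrite subsetD sAS -setI_eq0 -subset0; apply/subsetP => y; rewrite !inE.
    by move=> /andP[/andP[/negP yA _] /(subsetP cross)].
  - have -> : C :\: A \subset L; last by rewrite !orbT.
    by rewrite subDset (eqP cross).
have nSL : S :\: L != set0 by rewrite setD_eq0; move: pL; rewrite properE => /andP[].
have cL : #|S| = #|L| + #|S :\: L| by rewrite -(cardsID L S) (setIidPr sL).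
have cL0 : 0 < #|L| by rewrite card_gt0.
have cSL0 : 0 < #|S :\: L| by rewrite card_gt0.
have IH1 : #|flacets_within L| <= 3 * #|L| - 2 + (0 < num_flacet_sides L).
  by apply: IHm => //; [move: ltm cSL0; rewrite cL; clear; lia | exact: subset_trans sS].
have IH2 : #|flacets_within (S :\: L)| <=
    3 * #|S :\: L| - 2 + (0 < num_flacet_sides (S :\: L)).
  apply: IHm => //; last exact: subset_trans (subsetDl _ _) sS.
  by move: ltm cL0; rewrite cL; clear; lia.
have le_sub := leq_trans (subset_leq_card sub) (leq_card_setU _ _).
have two : num_flacet_sides S = 2 -> num_flacet_sides (S :\: L) = 0.
  rewrite /num_flacet_sides; case fS: (flacet S); case fCS: (flacet (C :\: S)) => // _.
  apply/eqP; rewrite -leqn0 leqNgt addn_gt0 !lt0b; apply/negP => w.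
  apply: (flacet_pair_no_tripartition fS fCS pL tL).
  case/orP: w => /flacet_two_separation //; rewrite two_separationC //.
  exact: subset_trans (subsetDl _ _) sSC.
have le2 : num_flacet_sides S <= 2 by rewrite /num_flacet_sides; do 2 case: flacet.
apply: leq_trans le_top _; apply: leq_trans (leq_add le_sub card_top) _.
move: IH1 IH2 two le2 cL0 cSL0; rewrite cL.
move: #|flacets_within L| #|flacets_within (S :\: L)| => f1 f2.
move: (num_flacet_sides S) (num_flacet_sides L) (num_flacet_sides (S :\: L)) => w w1 w2.
move: #|L| #|S :\: L| => l1 l2; clear.
by case: w => [|[|[|w]]] //; case: w1 => [|w1]; case: w2 => [|w2] //= *; lia.
Qed.

Lemma card_flacets_le : 1 < #|C| -> #|flacets| <= 3 * #|C| - 4.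
Proof.
move=> C1; have /set0Pn[x0 x0C] : C != set0 by rewrite -card_gt0 ltnW.
have cC := cardsD1 x0 C; rewrite x0C in cC.
have -> : flacets = flacets_within (C :\ x0).
  apply/setP => A; rewrite !inE; case fA: (flacet A) => //=; apply/esym.
  have /and3P[_ /proper_sub sA _] := flacet_two_separation fA.
  rewrite subsetD1 sA /= subsetD1 subsetDl /= inE x0C andbT negbK.
  by case: (x0 \in A).
apply: leq_trans (card_flacets_within_le C1 x0C (subxx _) _) _.
  by rewrite -card_gt0; lia.
by move: (leq_b1 (0 < num_flacet_sides (C :\ x0))); lia.
Qed.

Lemma flacets_eq0 : #|C| <= 1 -> flacets = set0.
Proof.
move=> C1; apply/setP => A; rewrite !inE; apply/negP => /flacet_two_separation /and3P[A0 pA _].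
by have := proper_card pA; rewrite -card_gt0 in A0; lia.
Qed.

End Flacets.

(** * Numerical estimates *)
Lemma bin_le_exp2 n k : 'C(n.+1, k) <= 2 ^ n.
Proof.
elim: n k => [|n IHn] [|k]; rewrite ?bin0 ?expn_gt0 //; first by case: k => [|k].
by rewrite binS expnS mul2n -addnn leq_add.
Qed.

(** The ratio 'C(n, k) / 2 ^ n does not grow with n, by Pascal's rule; 5 is the
    first n where it is at most 1/3 for all k. *)
Lemma bin_mul3_le n k : 4 < n -> 3 * 'C(n, k) <= 2 ^ n.
Proof.
elim: n k => // n IHn k; rewrite ltnS leq_eqVlt => /orP[/eqP <-|n4].
  by case: k => [|[|[|[|[|[|k]]]]]] //; rewrite bin_small.
case: k => [|k]; first by have := IHn 0 n4; rewrite !bin0 expnS; lia.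
by rewrite binS mulnDr expnS mul2n -addnn leq_add ?IHn.
Qed.

Lemma bin_lt_exp2 n k : 2 < n -> 'C(n, k) < 2 ^ n.-1.
Proof.
case: (leqP 5 n) => n4.
  have := bin_mul3_le k n4; case: n n4 => // n _.
  by rewrite expnS /=; have := expn_gt0 2 n; lia.
by case: n n4 => [|[|[|[|[|n]]]]] // _ _; case: k => [|[|[|[|[|k]]]]] //; rewrite bin_small.
Qed.

(** For n > 4 use 3 n - 4 < 3 (n - 1) and bin_mul3_le; the remaining cases are
    computed.  Equality at n = 4, k = 2 is the octahedron. *)
Lemma bin_facet_bound n k : 0 < n ->
  'C(n, k) * (3 * n - 4) <= n.-1 * 2 ^ n ?= iff
    [|| n == 1, (n == 2) && (k == 1) | (n == 4) && (k == 2)].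
Proof.
move=> n0; case: (leqP 5 n) => n4.
  have : 'C(n, k) * (3 * n - 4) < n.-1 * 2 ^ n.
    have := bin_mul3_le k n4; have : 0 < 2 ^ n by rewrite expn_gt0.
    move: (2 ^ n) ('C(n, k)) => N c N0 cN.
    by case: n n4 {n0} => // n n4 /=; nia.
  rewrite ltn_neqAle => /andP[/negPf neq le]; split=> //.
  by case: n n4 {n0 le} neq => [|[|[|[|[|n]]]]].
case: n n4 n0 => [|[|[|[|[|n]]]]] // _ _; split => //;
  by case: k => [|[|[|[|[|k]]]]] //; rewrite ?bin_small.
Qed.

(** Here i runs over the factors of a product polytope: a i bounds the number of
    vertices of a factor, b i the number of its facets and d i is its dimension.
    Vertices multiply while facets and dimensions add up. *)
Section ProductSum.
Import mathcomp.boot.fintype mathcomp.boot.finset.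
Context {I : finType} (P : {set I}) (a b d : I -> nat).
Hypothesis a_le : forall i, i \in P -> a i <= 2 ^ d i.
Hypothesis ab_le : forall i, i \in P -> a i * b i <= d i * 2 ^ (d i).+1.

Let rest i := \prod_(j in P | j != i) a j.
Let drest i := \sum_(j in P | j != i) d j.

Lemma rest_le i : rest i <= 2 ^ drest i.
Proof. by rewrite expn_sum; apply: leq_prod => j /andP[jP _]; exact: a_le. Qed.

Lemma prod_sumE :
  (\prod_(i in P) a i) * (\sum_(i in P) b i) = \sum_(i in P) (a i * b i) * rest i.
Proof. by rewrite big_distrr; apply: eq_bigr => i iP; rewrite (bigD1 i) //= mulnAC. Qed.

Lemma sum_expE : (\sum_(i in P) d i) * 2 ^ (\sum_(i in P) d i).+1 =
  \sum_(i in P) (d i * 2 ^ (d i).+1) * 2 ^ drest i.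
Proof.
rewrite big_distrl; apply: eq_bigr => i iP /=.
by rewrite [in 2 ^ _](bigD1 i) //= -mulnA -expnD addSn.
Qed.

Lemma prod_sum_le :
  (\prod_(i in P) a i) * (\sum_(i in P) b i) <=
  (\sum_(i in P) d i) * 2 ^ (\sum_(i in P) d i).+1.
Proof.
by rewrite prod_sumE sum_expE; apply: leq_sum => i iP; rewrite leq_mul ?ab_le ?rest_le.
Qed.

(** The i-th summand is strict as soon as another factor j falls short of
    2 ^ d j. *)
Lemma prod_sum_eq i j :
  (\prod_(i in P) a i) * (\sum_(i in P) b i) =
  (\sum_(i in P) d i) * 2 ^ (\sum_(i in P) d i).+1 ->
  i \in P -> j \in P -> i != j -> 0 < d i -> a j = 2 ^ d j.
Proof.
move=> eq_ab iP jP nij d0; apply/eqP; rewrite eqn_leq a_le //= leqNgt; apply/negP => lt_a.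
have: \sum_(i in P) (a i * b i) * rest i < \sum_(i in P) (d i * 2 ^ (d i).+1) * 2 ^ drest i.
  rewrite (bigD1 i) //= [X in _ < X](bigD1 i) //= -addSn.
  apply: leq_add; last first.
    by apply: leq_sum => k /andP[kP _]; rewrite leq_mul ?ab_le ?rest_le.
  apply: (@leq_trans (d i * 2 ^ (d i).+1 * rest i).+1).
    by rewrite ltnS leq_mul ?ab_le.
  rewrite ltn_pmul2l ?muln_gt0 ?d0 ?expn_gt0 //.
  rewrite /rest /drest (bigD1 j) /= ?jP 1?eq_sym //.
  rewrite [\sum_(_ in P | _) _](bigD1 j) /= ?jP 1?eq_sym // expnD.
  apply: (@leq_ltn_trans
    (a j * 2 ^ (\sum_(k | (k \in P) && (k != i) && (k != j)) d k))).
    rewrite leq_mul2l; apply/orP; right; rewrite expn_sum.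
    by apply: leq_prod => k /andP[/andP[kP _] _]; exact: a_le.
  by rewrite ltn_pmul2r ?expn_gt0.
by rewrite -prod_sumE -sum_expE eq_ab ltnn.
Qed.
End ProductSum.

(** * Bases and components *)
Section CountBases.
Import mathcomp.boot.fintype mathcomp.boot.finset.
Context {E : finType} (M : matroid E).
Implicit Types (A B C : {set E}).

Lemma cover_components : cover (components M) = setT.
Proof. by have /and3P[/eqP] := components_partition M. Qed.

Lemma mem_pblock_component x : pblock (components M) x \in components M.
Proof. by rewrite pblock_mem // cover_components. Qed.

Lemma basis_ext B1 B2 :
  (forall C, C \in components M -> B1 :&: C = B2 :&: C) -> B1 = B2.
Proof.
move=> eqB; apply/setP => x; have /setP/(_ x) := eqB _ (mem_pblock_component x).
by rewrite !inE mem_pblock cover_components inE !andbT.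
Qed.

Lemma component_card C B : C \in components M -> B \in bases M -> #|C :&: B| = rank M C.
Proof. by move=> CP BM; rewrite (separator_card (component_separator CP)). Qed.

(** A base is determined by its traces on the components, whose sizes are
    prescribed. *)
Lemma card_bases_le : #|bases M| <= \prod_(C in components M) 'C(#|C|, rank M C).
Proof.
pose tr B : {ffun {set E} -> {set E}} :=
  [ffun C : {set E} => if C \in components M then B :&: C else set0].
have tr_inj : {in bases M &, injective tr}.
  move=> B1 B2 _ _ /ffunP eqB; apply: basis_ext => C CP.
  by have := eqB C; rewrite !ffunE CP.
rewrite -(card_in_imset tr_inj).
pose F C := if C \in components M
  then [set D : {set E} | D \subset C & #|D| == rank M C] else [set set0].
have sub : tr @: bases M \subset family F.
  apply/subsetP => _ /imsetP[B BM ->]; apply/familyP => C; rewrite ffunE /F.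
  by case: ifP => CP; rewrite !inE // subsetIr setIC component_card //=.
apply: leq_trans (subset_leq_card sub) _; rewrite card_family foldrE big_map big_enum /=.
rewrite (bigID (mem (components M))) /= [X in _ * X]big1 ?muln1.
  by apply: leq_prod => C CP; rewrite /F CP cards_draws.
by move=> C /negPf nC; rewrite /F nC cards1.
Qed.

Lemma card_sum_components A : #|A| = \sum_(C in components M) #|A :&: C|.
Proof.
rewrite -sum1_card big_mkcond -(eq_bigl _ _ (@in_setT E)).
rewrite (set_partition_big _ (components_partition M)) /=; apply: eq_bigr => C _.
rewrite -sum1_card [RHS](eq_bigl (fun x => (x \in C) && (x \in A))) ?big_mkcondr // => x.
by rewrite inE andbC.
Qed.

Lemma sum_card_components : \sum_(C in components M) #|C| = #|E|.
Proof. by rewrite -(card_partition (components_partition M)) cardsT. Qed.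

Lemma sum_pred_card_components :
  \sum_(C in components M) #|C|.-1 = #|E| - #|components M|.
Proof.
rewrite -sum_card_components -sum1_card -sumnB.
  by apply: eq_bigr => C CP; rewrite subn1.
by move=> C CP; rewrite card_gt0; apply: component_neq0 CP.
Qed.

End CountBases.

Local Open Scope classical_set_scope.
Local Open Scope ring_scope.

(** * Affine hulls and their directions *)
Definition linear_of (R : pzRingType) (V W : lmodType R) (f : V -> W) (f_lin : linear f) :
  {linear V -> W} := HB.pack f (GRing.isLinear.Build R V W *:%R f f_lin).

Section Hulls.
Context {R : realType} {V : vectType R}.
Implicit Types (S P F : set V) (f g : {linear V -> R^o}) (U W : {vspace V}).

Lemma conv_hull_fin (I : finType) (a : I -> R) (x : I -> V) S :
  (forall i, S (x i)) -> (forall i, 0 <= a i) -> \sum_i a i = 1 ->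
  conv_hull S (\sum_i a i *: x i).
Proof.
move=> Sx a0 a1; exists #|I|, (a \o enum_val), (x \o enum_val); split => //=.
- by rewrite -a1 [RHS](reindex _ (onW_bij _ (enum_val_bij _))).
- by rewrite [LHS](reindex _ (onW_bij _ (enum_val_bij _))).
Qed.

Lemma aff_hull_fin (I : finType) (a : I -> R) (x : I -> V) S :
  (forall i, S (x i)) -> \sum_i a i = 1 -> aff_hull S (\sum_i a i *: x i).
Proof.
move=> Sx a1; exists #|I|, (a \o enum_val), (x \o enum_val); split => //=.
- by rewrite -a1 [RHS](reindex _ (onW_bij _ (enum_val_bij _))).
- by rewrite [LHS](reindex _ (onW_bij _ (enum_val_bij _))).
Qed.

Lemma sub_conv_hull S : S `<=` conv_hull S.
Proof.
move=> x Sx; have := @conv_hull_fin unit (fun=> 1) (fun=> x) S (fun=> Sx).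
by rewrite !big_const card_unit /= !addr0 scale1r; apply.
Qed.

Lemma sub_aff_hull S : S `<=` aff_hull S.
Proof.
move=> x Sx; have := @aff_hull_fin unit (fun=> 1) (fun=> x) S (fun=> Sx).
by rewrite !big_const card_unit /= !addr0 scale1r; apply.
Qed.

Lemma conv_hull_le S f c : (forall x, S x -> f x <= c) ->
  forall x, conv_hull S x -> f x <= c.
Proof.
move=> fc _ [n [a [x [Sx a0 a1 ->]]]]; rewrite linear_sum /=.
rewrite -[c]mul1r -a1 mulr_suml; apply: ler_sum => i _.
by rewrite linearZ; apply: ler_wpM2l; rewrite ?a0 ?fc.
Qed.

(** In a convex combination that attains the maximum, all points with a nonzero
    coefficient attain it; the others are replaced by one of these. *)
Lemma conv_hull_argmax S f c : (forall x, S x -> f x <= c) ->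
  forall x, conv_hull S x -> f x = c -> conv_hull [set x | S x /\ f x = c] x.
Proof.
move=> fc _ [n [a [x [Sx a0 a1 ->]]]]; rewrite linear_sum /= => fxc.
have eq0 i : a i * (c - f (x i)) = 0.
  have : \sum_i a i * (c - f (x i)) == 0.
    under eq_bigr do rewrite mulrBr.
    rewrite sumrB -mulr_suml a1 mul1r -{1}fxc subr_eq0; apply/eqP/eq_bigr => j _.
    by rewrite linearZ.
  rewrite psumr_eq0 => [|j _]; last by rewrite mulr_ge0 // subr_ge0 fc.
  by move=> /allP/(_ i)/(_ (mem_index_enum _))/eqP.
have [i0 ai0] : exists i, a i != 0.
  apply/existsP; apply: contraTT isT => /existsPn a_eq0.
  by move: a1; rewrite big1 => [/eqP|i _]; [rewrite eq_sym oner_eq0|apply/eqP/negPn].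
have f0 i : a i != 0 -> f (x i) = c.
  by move=> /negPf ai; have /eqP := eq0 i; rewrite mulf_eq0 ai subr_eq0 /= => /eqP ->.
pose x' i := if f (x i) == c then x i else x i0.
exists n, a, x'; split => // [i|].
  by rewrite /x'; case: ifP => [/eqP fi|_]; split=> //; apply: f0.
apply: eq_bigr => i _; rewrite /x'; case: ifP => // /eqP fi.
by case: (eqVneq (a i) 0) => [->|/f0 //]; rewrite !scale0r.
Qed.

Lemma aff_hull_shift S y p q t : aff_hull S y -> S p -> S q -> aff_hull S (y + t *: (p - q)).
Proof.
move=> [n [a [x [Sx a1 ->]]]] Sp Sq.
pose a' (i : option (option 'I_n)) :=
  if i is Some i then if i is Some i then a i else t else - t.
pose x' (i : option (option 'I_n)) :=
  if i is Some i then if i is Some i then x i else p else q.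
have split_sum (Z : nmodType) (G : option (option 'I_n) -> Z) :
  \sum_i G i = G None + (G (Some None) + \sum_i G (Some (Some i))).
  rewrite (bigD1 None) //=; congr (_ + _).
  rewrite (reindex_omap Some id) => /= [|[]//].
  rewrite (bigD1 None) //=; congr (_ + _).
    rewrite (reindex_omap Some id) => /= [|[]//].
  by apply: eq_bigl => i; rewrite !eqxx.
have -> : \sum_i a i *: x i + t *: (p - q) = \sum_i a' i *: x' i.
  by rewrite split_sum /= scalerBr scaleNr addrC -addrA addrCA.
by apply: aff_hull_fin => [[[]|]|] //=; rewrite split_sum /= addrA addNr add0r.
Qed.

(** Take U of maximal dimension among the subspaces with x0 + U inside the affine
    hull: a difference x - x0 outside U could be added to it. *)
Lemma direction_exists S x0 : S x0 -> exists U : {vspace V},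
  (forall x, S x -> x - x0 \in U) /\ (forall u, u \in U -> aff_hull S (x0 + u)).
Proof.
move=> Sx0.
pose Q n :=
  `[< exists2 U : {vspace V}, \dim U = n & forall u, u \in U -> aff_hull S (x0 + u) >].
have Q0 : exists n, Q n.
  exists 0%N; apply/asboolP; exists 0%VS; first by rewrite dimv0.
  by move=> u; rewrite memv0 => /eqP ->; rewrite addr0; apply: sub_aff_hull.
have Qb n : Q n -> (n <= \dim {:V})%N by move=> /asboolP[U <- _]; rewrite dimvS ?subvf.
case: (ex_maxnP Q0 Qb) => n /asboolP[U dU hU] maxn; exists U; split=> // x Sx.
apply/negPn/negP => xU; have : Q (\dim (U + <[x - x0]>)).
  apply/asboolP; exists (U + <[x - x0]>)%VS => // _ /memv_addP[u uU [_ /vlineP[t ->] ->]].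
  by rewrite addrA; apply: aff_hull_shift => //; exact: hU.
move/maxn; rewrite leqNgt => /negP; apply; rewrite -dU.
rewrite ltn_neqAle dimvS ?addvSl // andbT.
apply: contra xU => /eqP dE.
have /eqP -> : U == (U + <[x - x0]>)%VS by rewrite eqEdim addvSl dE /=.
by rewrite memvE addvSr.
Qed.

Lemma aff_directionP S x0 : S x0 -> exists z : V,
  aff_hull S = [set z + u | u in [set u | u \in aff_direction S]].
Proof.
move=> Sx0; rewrite /aff_direction; case: xgetP => [U _ [z ez]|]; first by exists z.
have [U [U1 U2]] := direction_exists Sx0.
move=> /(_ U) []; exists x0; apply/seteqP; split => [y|_ [u uU <-]]; last exact: U2.
move=> [n [a [x [Sx a1 ->]]]] /=; exists (\sum_i a i *: (x i - x0)).
  by apply: memv_suml => i _; rewrite memvZ // U1.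
under [X in _ + X]eq_bigr do rewrite scalerBr.
by rewrite sumrB -scaler_suml a1 scale1r addrC subrK.
Qed.

Lemma aff_direction_mem S x y : S x -> S y -> x - y \in aff_direction S.
Proof.
move=> Sx Sy; have [z ez] := aff_directionP Sx.
have := sub_aff_hull Sx; have := sub_aff_hull Sy; rewrite ez /= => -[v vD <-] [u uD <-].
by rewrite opprD addrACA subrr add0r memvB.
Qed.

(** Together with aff_direction_mem, this determines the direction as the
    smallest subspace that contains all differences of points of S. *)
Lemma aff_direction_min S x0 W : S x0 -> (forall x, S x -> x - x0 \in W) ->
  (aff_direction S <= W)%VS.
Proof.
move=> Sx0 SW; have [z ez] := aff_directionP Sx0.
have hW y : aff_hull S y -> y - x0 \in W.
  move=> [n [a [x [Sx a1 ->]]]].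
  have -> : \sum_i a i *: x i - x0 = \sum_i a i *: (x i - x0).
    by under [RHS]eq_bigr do rewrite scalerBr; rewrite sumrB -scaler_suml a1 scale1r.
  by apply: memv_suml => i _; rewrite memvZ // SW.
apply/subvP => u uD.
have h1 : z + u - x0 \in W by apply: hW; rewrite ez; exists u.
have h2 : z - x0 \in W by apply: hW; rewrite ez; exists 0; rewrite /= ?mem0v ?addr0.
by have := memvB h1 h2; rewrite opprB addrA subrK addrAC subrr add0r.
Qed.

Definition constant_on g S := forall x y, S x -> S y -> g x = g y.

Lemma constant_onP S x0 g : S x0 ->
  constant_on g S <-> (forall u, u \in aff_direction S -> g u = 0).
Proof.
move=> Sx0; split=> [gS u uD|g0 x y Sx Sy]; last first.
  by apply/eqP; rewrite -subr_eq0 -linearB g0 ?aff_direction_mem.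
have /subvP/(_ _ uD) : (aff_direction S <= lker (linfun g))%VS.
  apply: (aff_direction_min Sx0) => x Sx; rewrite memv_ker lfunE /=.
  by rewrite linearB /= (gS x x0) // subrr.
by rewrite memv_ker lfunE /= => /eqP.
Qed.

Lemma separating_functional U u : u \notin U ->
  exists2 g : {linear V -> R^o}, (forall v, v \in U -> g v = 0) & g u != 0.
Proof.
move=> uU; pose z := u - projv U u.
have /existsP[j zj] : [exists j, coord (vbasis {:V}) j z != 0].
  apply: contraR uU => /existsPn h.
  have /eqP : z = 0.
    rewrite (coord_vbasis (memvf z)) big1 // => j _.
    by have /negPn/eqP -> := h j; rewrite scale0r.
  by rewrite subr_eq0 => /eqP ->; exact: memv_proj.
pose g (v : V) : R^o := coord (vbasis {:V}) j (v - projv U v).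
have g_lin : linear g.
  by move=> t v w; rewrite /g linearP /= opprD addrACA -scalerBr linearP.
exists (linear_of g_lin) => [v vU|]; last exact: zj.
by rewrite /= /g projv_id // subrr linear0.
Qed.

End Hulls.

(** * Cardinals of finite families *)
Section CardFsetSet.
Local Open Scope fset_scope.

Lemma card_fset_set_finset (T : finType) (A : {set T}) :
  #|` fset_set [set x | x \in A]%classic| = #|A|.
Proof.
rewrite cardE; apply: perm_size; apply: uniq_perm; rewrite ?fset_uniq ?enum_uniq // => x.
by rewrite in_fset_set ?mem_enum; [apply/idP/idP; rewrite inE|exact: finite_finset].
Qed.

Lemma card_fset_set_image (T : finType) (U : choiceType) (A : {set T}) (f : T -> U) :
  {in A &, injective f} -> #|` fset_set [set f x | x in [set x | x \in A]]%classic| = #|A|.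
Proof.
move=> f_inj; rewrite fset_set_image; last exact: finite_finset.
rewrite card_in_imfset ?card_fset_set_finset //= => x y.
by rewrite !in_fset_set ?inE; [exact: f_inj|exact: finite_finset..].
Qed.

Lemma card_fset_set_range (T : finType) (U : choiceType) (f : T -> U) :
  injective f -> #|` fset_set (range f)| = #|T|.
Proof.
move=> f_inj; rewrite -cardsT -(card_fset_set_image (in2W f_inj)); congr (#|` fset_set _|).
by apply/seteqP; split => [_ [s _ <-]|_ [s _ <-]]; exists s => //=; rewrite inE.
Qed.

Lemma card_fset_set_bij (T U : choiceType) (A : set T) (f : T -> U) :
  finite_set A -> {in A &, injective f} ->
  #|` fset_set [set f x | x in A]%classic| = #|` fset_set A|.
Proof.
move=> finA f_inj; rewrite fset_set_image // card_in_imfset //= => x y.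
by rewrite !in_fset_set //; exact: f_inj.
Qed.

Lemma card_fset_set_le (T : finType) (U : choiceType) (A : {set T}) (f : T -> U) (X : set U) :
  (X `<=` [set f x | x in [set x | x \in A]])%classic -> (#|` fset_set X| <= #|A|)%N.
Proof.
move=> sX; have fin : finite_set [set f x | x in [set x | x \in A]]%classic.
  by apply: finite_image; exact: finite_finset.
have finX := sub_finite_set sX fin.
have /fsubset_leq_card le1 :
    fset_set X `<=` fset_set [set f x | x in [set x | x \in A]]%classic.
  by rewrite -fset_set_sub.
apply: leq_trans le1 _; rewrite fset_set_image; last exact: finite_finset.
apply: leq_trans (leq_imfset_card _ _ _) _ => /=.
by rewrite card_fset_set_finset.
Qed.

End CardFsetSet.

(** * Facets and functionals *)
Section Facets.
Context {R : realType} {V : vectType R}.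
Implicit Types (S P F : set V) (f g : {linear V -> R^o}) (U W : {vspace V}).

Definition combine g f (l : R) : {linear V -> R^o} :=
  [the {linear V -> R^o} of (linfun g - l *: linfun f)%VF : V -> R^o].

Lemma combineE g f l x : combine g f l x = g x - l * f x.
Proof. by rewrite /combine /= add_lfunE opp_lfunE scale_lfunE !lfunE. Qed.

(** The last property is how the codimension of a facet is used below: the direction
    of F is the kernel of f in the direction of P, so a functional that vanishes
    on the former is a multiple of f on the latter. *)
Lemma facet_functional P F : facets P F -> exists f c,
  [/\ forall x, P x -> f x <= c, F = [set x | P x /\ f x = c], F !=set0,
      exists2 x, P x & f x < c &
      forall g, constant_on g F -> exists l, constant_on (combine g f l) P].
Proof.
move=> [[f [c [fc eF]]] [x0 Fx0] dF]; exists f, c.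
have FP x : F x -> P x by rewrite eF => -[].
have Px0 := FP _ Fx0.
have fF : constant_on f F by move=> x y; rewrite eF => -[_ ->] [_ ->].
have sD : (aff_direction F <= aff_direction P)%VS.
  by apply: (aff_direction_min Fx0) => x Fx; apply: aff_direction_mem; exact: FP.
have [u uP fu] : exists2 u, u \in aff_direction P & f u != 0.
  apply: contrapT => nu; suff : F = P by move=> e; move: dF; rewrite /aff_dim e; lia.
  rewrite eF; apply/seteqP; split => [x []|x Px] //; split=> //.
  have fx0 : f x0 = c by move: Fx0; rewrite eF => -[].
  rewrite -fx0; apply: ((constant_onP f Px0).2 _) => // u uP.
  by apply/eqP/negPn/negP => fu; apply: nu; exists u.
have sDK : (aff_direction F <= aff_direction P :&: lker (linfun f))%VS.
  rewrite subv_cap sD /=; apply/subvP => v vF.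
  by rewrite memv_ker lfunE /= ((constant_onP f Fx0).1 fF).
have eDK : aff_direction F = (aff_direction P :&: lker (linfun f))%VS.
  apply/eqP; rewrite eqEdim sDK /= -ltnS; rewrite /aff_dim in dF; rewrite dF.
  rewrite ltn_neqAle dimvS ?capvSl // andbT; apply: contra fu => /eqP dE.
  have /eqP e : (aff_direction P :&: lker (linfun f))%VS == aff_direction P.
    by rewrite eqEdim capvSl /= dE.
  by move: uP; rewrite -e memv_cap memv_ker lfunE /= => /andP[].
split=> //; first by exists x0.
  apply: contrapT => nx; move/eqP: fu; apply.
  apply: ((constant_onP f Px0).1 _) => // x y Px Py.
  have e z : P z -> f z = c.
    move=> Pz; apply/eqP; rewrite eq_le fc //= leNgt; apply/negP => lt; apply: nx.
    by exists z.
  by rewrite !e.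
move=> g gF; exists (g u / f u).
apply/(constant_onP _ Px0) => v vP; rewrite combineE.
have : v - (f v / f u) *: u \in aff_direction F.
  rewrite eDK memv_cap memvB ?memvZ //= memv_ker lfunE /= linearB linearZ /=.
  by rewrite /GRing.scale /= divfK // subrr.
move/(proj1 (constant_onP g Fx0) gF); rewrite linearB linearZ /= /GRing.scale /=.
by move=> /eqP; rewrite subr_eq0 => /eqP ->; rewrite [X in X - _]mulrC mulrAC mulrA subrr.
Qed.

(** A converse: if the direction of the face were smaller than the kernel of f in
    the direction of P, a separating functional would violate the hypothesis. *)
Lemma facet_intro P f c x0 : (forall x, P x -> f x <= c) -> P x0 -> f x0 = c ->
  (exists2 x, P x & f x != c) ->
  (forall g, constant_on g [set x | P x /\ f x = c] ->
     exists l, constant_on (combine g f l) P) ->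
  facets P [set x | P x /\ f x = c].
Proof.
move=> fc Px0 fx0 [x1 Px1 fx1] gP; set F := [set x | _].
have Fx0 : F x0 by [].
have fF : constant_on f F by move=> x y [_ ->] [_ ->].
split; [by exists f, c | by exists x0 |].
have eD : aff_direction F = (aff_direction P :&: lker (linfun f))%VS.
  apply/eqP; rewrite eqEsubv subv_cap; apply/andP; split.
    rewrite (aff_direction_min Fx0) /=; last first.
      by move=> x [Px _]; apply: aff_direction_mem.
    apply/subvP => v vF; by rewrite memv_ker lfunE /= (proj1 (constant_onP f Fx0) fF).
  apply/subvP => v; rewrite memv_cap memv_ker lfunE /= => /andP[vP /eqP fv].
  apply/negPn/negP => vF; have [g g0 /eqP gv] := separating_functional vF; apply: gv.
  have [l gl] := gP g (proj2 (constant_onP g Fx0) g0).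
  have := proj1 (constant_onP _ Px0) gl v vP.
  by rewrite combineE fv mulr0 subr0.
rewrite /aff_dim eD -(limg_ker_dim (linfun f) (aff_direction P)) -addn1; congr (_ + _)%N.
apply/eqP; rewrite eqn_leq; apply/andP; split; last first.
  by apply: leq_trans (dimvS (subvf _)) _; rewrite dimvf.
rewrite lt0n dimv_eq0 -lkerE; apply/negP => /subvP/(_ (x1 - x0)).
rewrite aff_direction_mem // memv_ker lfunE /= linearB /= fx0 subr_eq0 => /(_ isT).
by rewrite (negPf fx1).
Qed.
End Facets.

(** * Affine isomorphisms preserve the numbers of faces *)
Section Isomorphism.
Context {R : realType}.

Lemma aff_dim_image_le (V W : vectType R) (f : {linear V -> W}) (b : W) (S : set V) x0 :
  S x0 -> (aff_dim [set (f x + b)%R | x in S] <= aff_dim S)%N.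
Proof.
move=> Sx0; apply: (@leq_trans (\dim (linfun f @: aff_direction S))).
  apply: dimvS; apply: (@aff_direction_min _ _ _ (f x0 + b)); first by exists x0.
  move=> _ [x Sx <-]; rewrite opprD addrACA subrr addr0 -linearB.
  by apply/memv_imgP; exists (x - x0); rewrite ?lfunE ?aff_direction_mem.
by rewrite /aff_dim -(limg_ker_dim (linfun f) (aff_direction S)) leq_addl.
Qed.

Lemma aff_dim_image (V W : vectType R) (f : {linear V -> W}) (b : W)
   (g : {linear W -> V}) (c : V) (S : set V) x0 :
  S x0 -> (forall x, S x -> g (f x + b) + c = x) ->
  aff_dim [set (f x + b)%R | x in S] = aff_dim S.
Proof.
move=> Sx0 fK; apply/eqP; rewrite eqn_leq (aff_dim_image_le _ _ Sx0) /=.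
have <- : [set (g y + c)%R | y in [set (f x + b)%R | x in S]] = S.
  apply/seteqP; split => [_ [_ [x Sx <-] <-]|x Sx]; first by rewrite fK.
  by exists (f x + b) => //; [exists x|rewrite fK].
have -> : [set (f x + b)%R | x in [set (g y + c)%R | y in [set (f x + b)%R | x in S]]] =
  [set (f x + b)%R | x in S].
  apply/seteqP; split => [_ [_ [_ [x Sx <-] <-] <-]|_ [x Sx <-]].
    by rewrite fK //; exists x.
  by exists x => //; exists (f x + b) => //; [exists x|rewrite fK].
by apply: (@aff_dim_image_le _ _ _ _ _ (f x0 + b)); exists x0.
Qed.

Variables (V W : vectType R) (P : set V) (Q : set W).

(** Carrying the inverse along makes the notion symmetric, so that faces need
    be transported in one direction only. *)
Definition affine_pair (f : {linear V -> W}) (b : W) (g : {linear W -> V}) (c : V) :=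
  [/\ forall x, P x -> Q (f x + b), forall y, Q y -> P (g y + c),
      forall x, P x -> g (f x + b) + c = x & forall y, Q y -> f (g y + c) + b = y].

(** The given map is onto Q, hence maps the direction of P onto a space that
    contains the direction of Q.  As the dimensions agree, it is injective on the
    direction of P and can be inverted there. *)
Lemma aff_isomorphic_inverse : aff_isomorphic P Q -> P !=set0 -> aff_dim P = aff_dim Q ->
  exists f b g c, affine_pair f b g c.
Proof.
move=> [f [b [fP finj fsurj]]] [x0 Px0] dPQ.
pose D := aff_direction P.
have kerD : (D :&: lker (linfun f) = 0)%VS.
  apply/eqP; rewrite -dimv_eq0; have := limg_ker_dim (linfun f) D.
  suff : (\dim D <= \dim (linfun f @: D))%N by lia.
  rewrite [\dim D]dPQ; apply: dimvS.
  apply: (@aff_direction_min _ _ _ (f x0 + b)); first exact: fP.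
  move=> y Qy; have [x Px <-] := fsurj y Qy.
  rewrite opprD addrACA subrr addr0 -linearB.
  by apply/memv_imgP; exists (x - x0); rewrite ?lfunE ?aff_direction_mem.
pose h := (linfun f \o projv D)%VF.
pose g := (projv D \o h^-1)%VF.
have gK u : u \in D -> g (f u) = u.
  move=> uD; have hu : h u = f u by rewrite comp_lfunE projv_id // lfunE.
  rewrite -hu; apply/eqP; rewrite -subr_eq0 -memv0 -kerD memv_cap memvB //; last first.
    by rewrite comp_lfunE memv_proj.
  rewrite memv_ker linearB /= subr_eq0 -[X in _ == X]/(linfun f u) [linfun f u]lfunE /= -hu.
  have e : h (h^-1%VF (h u)) = h u by apply: limg_lfunVK; rewrite memv_img ?memvf.
  by rewrite -[X in _ == X]e [h (h^-1%VF _)]comp_lfunE [g _]comp_lfunE.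
pose c := x0 - g (f x0 + b).
have gfK x : P x -> g (f x + b) + c = x.
  move=> Px; have e : g (f x + b) - g (f x0 + b) = x - x0.
    rewrite -[LHS]linearB opprD addrACA subrr addr0 -[f x - f x0]linearB.
    exact: (gK _ (aff_direction_mem Px Px0)).
  by rewrite /c addrCA e addrC subrK.
exists f, b, [the {linear W -> V} of g : W -> V], c; split => //=.
  by move=> y Qy; have [x Px <-] := fsurj y Qy; rewrite gfK.
by move=> y Qy; have [x Px <-] := fsurj y Qy; rewrite gfK.
Qed.

End Isomorphism.

Section Transfer.
Context {R : realType}.

Lemma affine_pair_sym (V W : vectType R) (P : set V) (Q : set W) f b g c :
  affine_pair P Q f b g c -> affine_pair Q P g c f b.
Proof. by case. Qed.

Lemma affine_pair_face (V W : vectType R) (P : set V) (Q : set W) f b g c F :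
  affine_pair P Q f b g c -> face P F -> face Q [set (f x + b)%R | x in F].
Proof.
move=> [fP gQ gfK fgK] [h [k [hk ->]]].
pose hg : {linear W -> R^o} := [the {linear W -> R^o} of h \o g].
have hgE y : h (g y + c) = hg y + h c by rewrite linearD.
exists hg, (k - h c); split=> [y Qy|]; first by rewrite lerBrDr -hgE; exact/hk/gQ.
apply/seteqP; split => [_ [x [Px hx] <-]|y [Qy hy]] /=.
  by split; [exact: fP|apply/eqP; rewrite eq_sym subr_eq -hgE gfK // hx].
exists (g y + c); last by rewrite fgK.
by split; [exact: gQ|rewrite hgE hy subrK].
Qed.

Lemma affine_pair_facet (V W : vectType R) (P : set V) (Q : set W) f b g c F :
  affine_pair P Q f b g c -> facets P F -> facets Q [set (f x + b)%R | x in F].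
Proof.
move=> pq [fF [x0 Fx0] dF]; split; first exact: affine_pair_face pq fF.
  by exists (f x0 + b), x0.
have FP : F `<=` P by case: fF => h [k [_ ->]] x [].
case: pq => [fP gQ gfK fgK].
rewrite (@aff_dim_image _ _ _ f b g c F x0) // => [|x /FP]; last exact: gfK.
rewrite dF -(@aff_dim_image _ _ _ f b g c P x0) //; last exact: FP.
congr aff_dim; apply/seteqP; split => [_ [x Px <-]|y Qy]; first exact: fP.
by exists (g y + c); [exact: gQ|rewrite fgK].
Qed.

Lemma num_vertices_affine_pair (V W : vectType R) (P : set V) (Q : set W) f b g c :
  affine_pair P Q f b g c -> finite_set (vertices Q) -> num_vertices P = num_vertices Q.
Proof.
move=> pq fin; rewrite /num_vertices.
have sub x : vertices P x -> P x.
  by case=> h [k [_ /seteqP[/(_ x)]]] sx _; case: (sx erefl).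
have subQ y : vertices Q y -> Q y.
  by case=> h [k [_ /seteqP[/(_ y)]]] sx _; case: (sx erefl).
have -> : vertices P = [set (g y + c)%R | y in vertices Q].
  apply/seteqP; split => [x vx|_ [y vy <-]].
    exists (f x + b); last by case: pq => _ _ -> //; exact: sub.
    by have := affine_pair_face pq vx; rewrite image_set1.
  by have := affine_pair_face (affine_pair_sym pq) vy; rewrite image_set1.
apply: card_fset_set_bij fin _ => y1 y2 /set_mem v1 /set_mem v2 e.
by case: pq => _ _ _ fgK; rewrite -(fgK y1) ?e ?fgK //; exact: subQ.
Qed.

Lemma num_facets_affine_pair (V W : vectType R) (P : set V) (Q : set W) f b g c :
  affine_pair P Q f b g c -> finite_set (facets Q) -> num_facets P = num_facets Q.
Proof.
move=> pq fin; rewrite /num_facets.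
have sub (U : vectType R) (S : set U) F : facets S F -> F `<=` S.
  by move=> [[h [k [_ ->]]] _ _] x [].
have imK (U U' : vectType R) (S : set U) (S' : set U') f' b' g' c' F :
    affine_pair S S' f' b' g' c' -> F `<=` S ->
    [set (g' y + c')%R | y in [set (f' x + b')%R | x in F]] = F.
  move=> [_ _ gfK _] FS; apply/seteqP; split => [_ [_ [x Fx <-] <-]|x Fx].
    by rewrite gfK //; exact: FS.
  by exists (f' x + b'); [exists x|rewrite gfK //; exact: FS].
have -> : facets P = [set [set (g y + c)%R | y in F] | F in facets Q].
  apply/seteqP; split => [F fF|_ [F fF <-]]; last exact: affine_pair_facet (affine_pair_sym pq) fF.
  exists [set (f x + b)%R | x in F]; first exact: affine_pair_facet pq fF.
  exact: imK pq (sub _ _ _ fF).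
apply: card_fset_set_bij fin _ => F1 F2 /set_mem f1 /set_mem f2 e.
by rewrite -(imK _ _ _ _ _ _ _ _ _ (affine_pair_sym pq) (sub _ _ _ f1)) e
  (imK _ _ _ _ _ _ _ _ _ (affine_pair_sym pq) (sub _ _ _ f2)).
Qed.
End Transfer.

(** * Vertices and images of convex hulls *)
Lemma functionalZ (R : realType) (V : vectType R) (f : {linear V -> R^o}) a x :
  f (a *: x) = a * f x.
Proof. exact: linearZ. Qed.

Section ConvexHullMore.
Context {R : realType} {V : vectType R}.
Implicit Types (S P F : set V) (f g : {linear V -> R^o}).

Lemma conv_hull_neq0 S x : conv_hull S x -> S !=set0.
Proof.
move=> [[|n] [a [y [Sy _ a1 _]]]]; last by exists (y ord0).
by move: a1; rewrite big_ord0 => /eqP; rewrite eq_sym oner_eq0.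
Qed.

Lemma conv_hull_set1 (x y : V) : conv_hull [set x] y -> y = x.
Proof.
move=> [n [a [z [zx _ a1 ->]]]]; under eq_bigr do rewrite (zx _).
by rewrite -scaler_suml a1 scale1r.
Qed.

Lemma conv_hull_mono S P : S `<=` P -> conv_hull S `<=` conv_hull P.
Proof. by move=> SP y [n [a [x [Sx ? ? ->]]]]; exists n, a, x; split=> // i; apply: SP. Qed.

(** A vertex, being a face, is the hull of the generators that lie on it, so it
    is one of them. *)
Lemma vertices_conv_hull S :
  (forall x, S x -> exists f, forall y, S y -> y <> x -> f y < f x) ->
  vertices (conv_hull S) = S.
Proof.
move=> expS; apply/seteqP; split => x.
  move=> [f [c [fc /seteqP[sx xs]]]]; have [Px fx] := sx x erefl.
  have fS z : S z -> f z <= c by move=> Sz; apply/fc/sub_conv_hull.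
  have [y [Sy fy]] := conv_hull_neq0 (conv_hull_argmax fS Px fx).
  by have -> : x = y by apply/esym/xs; split=> //; exact: sub_conv_hull.
move=> Sx; have [f fx] := expS x Sx.
have lefx y : S y -> f y <= f x.
  by move=> Sy; have [->//|/eqP nyx] := eqVneq y x; apply/ltW/fx.
exists f, (f x); split; first exact: conv_hull_le.
apply/seteqP; split => [_ ->|y [Py fy]]; first by split=> //; exact: sub_conv_hull.
apply: conv_hull_set1; apply: conv_hull_mono (conv_hull_argmax lefx Py fy) => z [Sz fz] /=.
by apply: contrapT => nzx; have := fx z Sz nzx; rewrite fz ltxx.
Qed.

Lemma conv_hull_image (W : vectType R) (f : {linear V -> W}) (b : W) S :
  [set (f x + b)%R | x in conv_hull S] = conv_hull [set (f x + b)%R | x in S].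
Proof.
apply/seteqP; split => [_ [_ [n [a [x [Sx a0 a1 ->]]]] <-]|_ [n [a [y [Sy a0 a1 ->]]]]].
  exists n, a, (fun i => f (x i) + b); split=> // [i|]; first by exists (x i).
  under [RHS]eq_bigr do rewrite scalerDr.
  rewrite big_split /= -scaler_suml a1 scale1r linear_sum; congr (_ + _).
  by apply: eq_bigr => i _; rewrite linearZ.
pose x i := projT1 (cid2 (Sy i)).
have xS i : S (x i) by rewrite /x; case: cid2.
have xy i : f (x i) + b = y i by rewrite /x; case: cid2.
exists (\sum_i a i *: x i); first by exists n, a, x.
rewrite linear_sum -[b]scale1r -a1 scaler_suml -big_split /=.
by apply: eq_bigr => i _; rewrite linearZ -scalerDr xy.
Qed.

End ConvexHullMore.

(** * Faces of the cube *)
Section StandardPolytopes.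
Context {R : realType} {d : nat}.
Implicit Types (x y w : 'rV[R]_d) (i j : 'I_d) (b : bool).

Definition dot w (x : 'rV[R]_d) : R^o := \sum_i w 0 i * x 0 i.

Lemma dot_linear w : linear (dot w).
Proof.
move=> t x y; rewrite /dot /GRing.scale /= mulr_sumr -big_split /=.
by apply: eq_bigr => i _; rewrite !mxE; ring.
Qed.
HB.instance Definition _ w := GRing.isLinear.Build R 'rV[R]_d R^o *:%R (dot w) (dot_linear w).

Lemma dotC x y : dot x y = dot y x.
Proof. by apply: eq_bigr => i _; rewrite mulrC. Qed.

Lemma dot_delta w i : dot w (delta_mx 0 i) = w 0 i.
Proof.
rewrite /dot (bigD1 i) //= !mxE !eqxx mulr1 big1 ?addr0 // => j /negPf nj.
by rewrite !mxE nj andbF mulr0.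
Qed.

Lemma functional_dot (f : {linear 'rV[R]_d -> R^o}) x :
  f x = dot (\row_i f (delta_mx 0 i)) x.
Proof.
rewrite {1}(row_sum_delta x) linear_sum; apply: eq_bigr => i _.
by rewrite linearZ mxE mulrC.
Qed.

(** Points on a common sphere are exposed by their own scalar product, since
    dot (x - y) (x - y) > 0. *)
Lemma dot_lt x y : dot x x = dot y y -> y <> x -> dot x y < dot x x.
Proof.
move=> exy nyx; suff : 0 < dot (x - y) (x - y).
  by rewrite linearB /= ![dot (x - y) _]dotC !linearB /= (dotC y x) -exy; lra.
rewrite lt_neqAle; apply/andP; split; last first.
  by apply: sumr_ge0 => i _; rewrite -expr2 sqr_ge0.
rewrite eq_sym psumr_eq0; last by move=> i _; rewrite -expr2 sqr_ge0.
apply/negP => /allP h; apply: nyx; apply/rowP => i.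
have := h i (mem_index_enum _); rewrite /= mulf_eq0 orbb !mxE subr_eq0.
by move=> /eqP.
Qed.

Definition sign b : R := (-1) ^+ b.

Lemma signK b : sign b * sign b = 1.
Proof. by rewrite /sign; case: b; rewrite ?expr0 ?expr1 ?mulr1 ?mulrNN ?mulr1. Qed.

Lemma sign_inj : injective sign.
Proof. exact: signr_inj. Qed.

Lemma sign_abs (t : R) : sign (t < 0) * t = `|t|.
Proof.
rewrite /sign; case: ltP => t0; rewrite ?expr0 ?expr1 ?mul1r ?mulN1r.
  by rewrite ltr0_norm.
by rewrite ger0_norm.
Qed.

Lemma normr_signb b : `|sign b| = 1.
Proof. by rewrite /sign; case: b; rewrite ?expr0 ?expr1 ?normrN normr1. Qed.

Definition sign_vec (s : {ffun 'I_d -> bool}) : 'rV[R]_d := \row_i sign (s i).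

Lemma sign_vec_inj : injective sign_vec.
Proof. by move=> s t /rowP e; apply/ffunP => i; have := e i; rewrite !mxE => /sign_inj. Qed.

Lemma aff_dim_full (S : set 'rV[R]_d) : S 0 -> (forall i, S (delta_mx 0 i)) -> aff_dim S = d.
Proof.
move=> S0 Se; suff /eqP e : aff_direction S == fullv.
  by rewrite /aff_dim e dimvf /dim /= mul1n.
rewrite eqEsubv subvf /=; apply/subvP => u _; rewrite (row_sum_delta u).
apply: memv_suml => i _; apply: memvZ; rewrite -[delta_mx _ _]subr0.
exact: aff_direction_mem.
Qed.

Lemma cubeP x : cube R d x <-> forall i, `|x 0 i| <= 1.
Proof. by split=> h i; have := h i; rewrite ler_norml. Qed.

(** The weight of the sign vector s is the product of the (1 + s i * x i) / 2, the
    law of independent random signs with mean x; expanding the product of sums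
    yields both the total weight and the coordinates. *)
Lemma cube_conv_hull : cube R d = conv_hull (range sign_vec).
Proof.
apply/seteqP; split => [x xc|_ [n [a [y [Sy a0 a1 ->]]]]]; last first.
  apply/cubeP => i; rewrite summxE -a1; apply: le_trans (ler_norm_sum _ _ _) _.
  apply: ler_sum => k _; rewrite mxE normrM (ger0_norm (a0 k)).
  by have [s _ <-] := Sy k; rewrite mxE normr_signb mulr1.
pose h i b := (1 + sign b * x 0 i) / 2.
have h0 i b : 0 <= h i b.
  have /andP[l u] := xc i.
  by rewrite /h divr_ge0 // /sign; case: b; rewrite ?expr0 ?expr1 ?mul1r ?mulN1r; lra.
have hS i : \sum_b sign b * h i b = x 0 i.
  by rewrite big_bool /h /sign /= expr0 expr1; field.
have hS1 i : \sum_b h i b = 1.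
  by rewrite big_bool /h /sign /= expr0 expr1; field.
have -> : x = \sum_(s : {ffun 'I_d -> bool}) (\prod_i h i (s i)) *: sign_vec s.
  apply/rowP => j; rewrite summxE.
  pose h' i b := if i == j then sign b * h i b else h i b.
  transitivity (\prod_i \sum_b h' i b).
    rewrite (bigD1 j) //= [X in _ * X]big1 ?mulr1 => [|i /negPf nij].
      by rewrite /h'; rewrite -hS; apply: eq_bigr => b _; rewrite eqxx.
    by rewrite /h'; rewrite -(hS1 i); apply: eq_bigr => b _; rewrite nij.
  rewrite bigA_distr_bigA; apply: eq_bigr => s _; rewrite !mxE.
  rewrite (bigD1 j) //= [in RHS](bigD1 j) //= /h' eqxx [RHS]mulrAC [sign _ * _]mulrC.
  congr (_ * _).
  by apply: eq_bigr => i /negPf ->.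
apply: conv_hull_fin => [s|s|]; first by exists s.
- by apply: prodr_ge0.
- by rewrite -bigA_distr_bigA big1.
Qed.

Lemma vertices_cube : vertices (cube R d) = range sign_vec.
Proof.
rewrite cube_conv_hull; apply: vertices_conv_hull => _ [s _ <-].
exists [the {linear _ -> _} of dot (sign_vec s)] => _ [t _ <-] nts /=; apply: dot_lt => //.
by apply: eq_bigr => i _; rewrite !mxE !signK.
Qed.

Lemma num_vertices_cube : num_vertices (cube R d) = (2 ^ d)%N.
Proof.
rewrite /num_vertices vertices_cube.
by rewrite (card_fset_set_range sign_vec_inj) card_ffun card_bool card_ord.
Qed.

Definition cube_facet (ib : 'I_d * bool) : set 'rV[R]_d :=
  [set x | cube R d x /\ dot (sign ib.2 *: delta_mx 0 ib.1) x = 1].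

Lemma dot_sign_delta b i x : dot (sign b *: delta_mx 0 i) x = sign b * x 0 i.
Proof. by rewrite dotC linearZ /= dot_delta. Qed.

Lemma cube_0 : cube R d 0.
Proof. by move=> i; rewrite mxE; lra. Qed.

(** If a functional has a nonzero coefficient at i, then the i-th coordinate is
    constant on the face where it is maximal; by facet_functional it is then a
    multiple of this coordinate. *)
Lemma facets_cube : facets (cube R d) = range cube_facet.
Proof.
apply/seteqP; split => [F|_ [[i b] _ <-]].
  move=> /facet_functional[f [c [fc eF [x0 Fx0] [x1 Px1 fx1] hF]]].
  have [Px0 fx0] : cube R d x0 /\ f x0 = c by move: Fx0; rewrite eF.
  have [i fi] : exists i, f (delta_mx 0 i) != 0.
    apply/existsP; apply: contraTT isT => /existsPn f0.
    have f00 x : f x = 0.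
      by rewrite functional_dot /dot big1 // => i _; rewrite mxE (eqP (negPn (f0 i))) mul0r.
    by move: fx1; rewrite -fx0 !f00 ltxx.
  pose b := f (delta_mx 0 i) < 0.
  have Fi x : F x -> sign b * x 0 i = 1.
    rewrite eF => -[Px fx].
    pose x' := x + (sign b - x 0 i) *: delta_mx 0 i.
    have /fc : cube R d x'.
      move=> j; rewrite !mxE; case: (eqVneq j i) => [->|nji]; rewrite /= ?mulr1 ?mulr0 ?addr0 //.
      by rewrite addrC subrK; have := normr_signb b; rewrite -ler_norml => ->.
    rewrite linearD functionalZ fx gerDl mulrBl sign_abs.
    have xi1 : sign b * x 0 i <= 1.
      by apply: le_trans (ler_norm _) _; rewrite normrM normr_signb mul1r; exact: (cubeP x).1 Px i.
    have fs : f (delta_mx 0 i) = sign b * `|f (delta_mx 0 i)|.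
      by rewrite -sign_abs mulrA signK mul1r.
    have n0 : 0 < `|f (delta_mx 0 i)| by rewrite normr_gt0.
    rewrite {2}fs mulrCA mulrA; set n := Num.norm _ in n0 *.
    rewrite -{1}[n]mul1r -mulrBl pmulr_lle0 //.
    by move=> xi2; apply/eqP; rewrite eq_le xi1 /= -subr_le0.
  exists (i, b) => //; apply/seteqP; split => x; last first.
    by move=> Fx; split; [by move: Fx; rewrite eF => -[]|rewrite dot_sign_delta Fi].
  move=> [Px]; rewrite dot_sign_delta /= => xi.
  have := hF [the {linear _ -> _} of dot (sign b *: delta_mx 0 i)]; case=> [y z Fy Fz|l hl].
    by rewrite /= !dot_sign_delta !Fi.
  have /eqP := hl x x0 Px Px0; rewrite !combineE /= !dot_sign_delta xi (Fi _ Fx0).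
  have l0 : l != 0.
    apply/negP => /eqP l0; have := hl 0 x0 cube_0 Px0.
    rewrite !combineE l0 !mul0r !subr0 /= !dot_sign_delta mxE mulr0 (Fi _ Fx0) => /eqP.
    by rewrite eq_sym oner_eq0.
  rewrite (inj_eq (addrI _)) eqr_opp (inj_eq (mulfI l0)) eF fx0 => /eqP fx.
  by split.
have Psi : cube R d (sign b *: delta_mx 0 i).
  move=> j; rewrite !mxE -ler_norml normrM normr_signb mul1r.
  by case: (_ && _); rewrite ?normr1 ?normr0 ?ler01.
apply: (@facet_intro _ _ _ [the {linear _ -> _} of dot (sign b *: delta_mx 0 i)] 1
  (sign b *: delta_mx 0 i)) => //=.
- move=> x Px; rewrite dot_sign_delta; apply: le_trans (ler_norm _) _.
  by rewrite normrM normr_signb mul1r; exact: (cubeP x).1 Px i.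
- by rewrite dot_sign_delta !mxE !eqxx mulr1 signK.
- by exists 0; [exact: cube_0|rewrite linear0 eq_sym oner_eq0].
move=> g gF; exists (sign b * g (delta_mx 0 i)) => x y Px Py.
have gj j : j != i -> g (delta_mx 0 j) = 0.
  move=> nji; have Psij : cube R d (sign b *: delta_mx 0 i + delta_mx 0 j).
    move=> k; rewrite !mxE -ler_norml /=; case: (eqVneq k i) => [->|nki].
      by rewrite mulr1 eq_sym (negPf nji) addr0 normr_signb.
    by rewrite mulr0 add0r; case: (_ == _); rewrite ?normr1 ?normr0 ?ler01.
  have e1 : dot (sign b *: delta_mx 0 i) (sign b *: delta_mx 0 i + delta_mx 0 j) = 1.
    by rewrite dot_sign_delta !mxE !eqxx (eq_sym i) (negPf nji) mulr1 addr0 signK.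
  have e2 : dot (sign b *: delta_mx 0 i) (sign b *: delta_mx 0 i) = 1.
    by rewrite dot_sign_delta !mxE !eqxx mulr1 signK.
  have := gF _ _ (conj Psij e1) (conj Psi e2); rewrite linearD => h.
  by apply: (addrI (g (sign b *: delta_mx 0 i))); rewrite addr0.
have gx z : combine g [the {linear _ -> _} of dot (sign b *: delta_mx 0 i)]
    (sign b * g (delta_mx 0 i)) z = 0.
  rewrite combineE /= dot_sign_delta functional_dot /dot (bigD1 i) //= big1 ?addr0 => [|j nji].
    by rewrite !mxE mulrACA signK mul1r subrr.
  by rewrite mxE gj // mul0r.
by rewrite !gx.
Qed.

Lemma cube_facet_inj : injective cube_facet.
Proof.
move=> [i b] [j c] e; pose x : 'rV[R]_d := \row_k (if k == i then sign b else - sign c).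
have : cube_facet (i, b) x.
  split; last by rewrite dot_sign_delta mxE eqxx signK.
  by apply/cubeP => k; rewrite mxE; case: ifP; rewrite ?normrN normr_signb.
rewrite e => -[_]; rewrite dot_sign_delta mxE /=; case: eqVneq => [->|_] h.
  congr (_, _); apply: sign_inj; rewrite -[LHS]mul1r -(signK c) -mulrA h mulr1.
  by [].
by move: h; rewrite mulrN signK => h; have : (1:R) > -1 by [lra]; rewrite h ltxx.
Qed.

Lemma num_facets_cube : num_facets (cube R d) = (d * 2)%N.
Proof.
rewrite /num_facets facets_cube.
by rewrite (card_fset_set_range cube_facet_inj) card_prod card_bool card_ord.
Qed.

End StandardPolytopes.

(** * Faces of the cross-polytope *)
Section CrossPolytope.
Context {R : realType} {d : nat}.
Implicit Types (x y w : 'rV[R]_d) (i j : 'I_d) (b : bool).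

Definition cross_vertex (ib : 'I_d * bool) : 'rV[R]_d := @sign R ib.2 *: delta_mx 0 ib.1.

Lemma cross_polytopeP y : cross_polytope R d y <-> \sum_i `|y 0 i| <= 1.
Proof.
split=> [yQ|y1 x /cubeP xc]; last first.
  apply: le_trans y1; apply: ler_sum => i _; apply: le_trans (ler_norm _) _.
  by rewrite normrM ler_piMl.
have /yQ : cube R d (\row_i sign (y 0 i < 0)).
  by apply/cubeP => i; rewrite mxE normr_signb.
by apply: le_trans; apply: ler_sum => i _; rewrite mxE sign_abs.
Qed.

Lemma cross_vertexE ib i : cross_vertex ib 0 i = sign ib.2 * (i == ib.1)%:R.
Proof. by rewrite !mxE eqxx. Qed.

Lemma cross_vertex_in ib : cross_polytope R d (cross_vertex ib).
Proof.
apply/cross_polytopeP; rewrite (bigD1 ib.1) //= big1 ?addr0 => [|i /negPf ni].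
  by rewrite cross_vertexE eqxx mulr1 normr_signb.
by rewrite cross_vertexE ni mulr0 normr0.
Qed.

Lemma cross_0 : cross_polytope R d 0.
Proof. by apply/cross_polytopeP; rewrite big1 // => i _; rewrite mxE normr0. Qed.

Lemma cross_vertex_inj : injective cross_vertex.
Proof.
move=> [i b] [j c] /rowP e; have := e i; rewrite !cross_vertexE /= eqxx mulr1.
case: eqVneq => [->|_]; first by rewrite mulr1 => /sign_inj ->.
by move=> /eqP; rewrite mulr0 -normr_eq0 normr_signb oner_eq0.
Qed.

(** The slack 1 - sum of the |y i| is spread evenly over all vertices, which
    does not move the point as they sum to 0.  In dimension 0 there are no
    vertices to take the hull of. *)
Lemma cross_polytope_conv_hull : (0 < d)%N ->
  cross_polytope R d = conv_hull (range cross_vertex).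
Proof.
move=> d0; apply/seteqP; split => [y yQ|_ [n [a [y [Sy a0 a1 ->]]]]]; last first.
  apply/cross_polytopeP; rewrite -a1.
  apply: (@le_trans _ _ (\sum_i \sum_k `|a k * y k 0 i|)).
    apply: ler_sum => i _; rewrite summxE; apply: le_trans (ler_norm_sum _ _ _) _.
    by apply: ler_sum => k _; rewrite mxE.
  rewrite exchange_big /=; apply: ler_sum => k _.
  under eq_bigr do rewrite normrM (ger0_norm (a0 k)).
  rewrite -mulr_sumr ler_piMr //; have [ib _ <-] := Sy k.
  exact/cross_polytopeP/cross_vertex_in.
have /cross_polytopeP y1 := yQ.
pose t := (1 - \sum_i `|y 0 i|) / (2 * d%:R).
have dR : (d%:R : R) != 0 by rewrite pnatr_eq0 -lt0n.
pose a (ib : 'I_d * bool) := (`|y 0 ib.1| + sign ib.2 * y 0 ib.1) / 2 + t.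
have t0 : 0 <= t by rewrite divr_ge0 ?subr_ge0 // mulr_ge0 // ler0n.
have -> : y = \sum_ib a ib *: cross_vertex ib.
  apply/rowP => j; rewrite summxE.
  rewrite -(pair_bigA _ (fun i b => (a (i, b) *: cross_vertex (i, b)) 0 j)) /=.
  rewrite (bigD1 j) //= [X in _ + X]big1 ?addr0 => [|i /negPf nij]; last first.
    by apply: big1 => b _; rewrite mxE cross_vertexE eq_sym nij !mulr0.
  rewrite big_bool /= !mxE !eqxx /a /sign /= expr0 expr1; by field; rewrite ?dR.
apply: conv_hull_fin => [ib|ib|]; first by exists ib.
  rewrite /a addr_ge0 // divr_ge0 // -lerBlDr sub0r; apply: le_trans (ler_norm _) _.
  by rewrite normrN normrM normr_signb mul1r.
rewrite -(pair_bigA _ (fun i b => a (i, b))) /=.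
have e i : \sum_b a (i, b) = `|y 0 i| + 2 * t.
  by rewrite big_bool /a /sign /= expr0 expr1; field.
under eq_bigr do rewrite e.
rewrite big_split /= sumr_const card_ord -mulr_natr /t; field.
by rewrite ?dR.
Qed.

Lemma vertices_cross : (0 < d)%N ->
  vertices (cross_polytope R d) = range cross_vertex.
Proof.
move=> d0; rewrite cross_polytope_conv_hull //; apply: vertices_conv_hull => _ [s _ <-].
exists [the {linear _ -> _} of dot (cross_vertex s)] => _ [t _ <-] nts /=; apply: dot_lt => //.
have e u : dot (cross_vertex u) (cross_vertex u) = 1.
  by rewrite {1}/cross_vertex dot_sign_delta cross_vertexE eqxx mulr1 signK.
by rewrite !e.
Qed.

Lemma num_vertices_cross : (0 < d)%N -> num_vertices (cross_polytope R d) = (d * 2)%N.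
Proof.
move=> d0; rewrite /num_vertices vertices_cross //.
by rewrite (card_fset_set_range cross_vertex_inj) card_prod card_bool card_ord.
Qed.

Definition cross_facet (s : {ffun 'I_d -> bool}) : set 'rV[R]_d :=
  [set x | cross_polytope R d x /\ dot (sign_vec s) x = 1].

(** The maximum of f is the largest |f e_i|.  If some |f e_i| were smaller,
    the i-th coordinate would vanish on F, so f would be a multiple of it and
    vanish on F.  Hence all |f e_i| agree and only their signs matter. *)
Lemma facets_cross : (0 < d)%N ->
  facets (cross_polytope R d) = range cross_facet.
Proof.
move=> d0; apply/seteqP; split => [F|_ [s _ <-]].
  move=> /facet_functional[f [c [fc eF [x0 Fx0] [x1 Px1 fx1] hF]]].
  have [Px0 fx0] : cross_polytope R d x0 /\ f x0 = c by move: Fx0; rewrite eF.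
  have fic i : `|f (delta_mx 0 i)| <= c.
    rewrite -sign_abs -functionalZ; apply: fc.
    exact: (cross_vertex_in (i, _)).
  have c0 : 0 < c.
    rewrite lt_neqAle -{2}(linear0 f) fc ?andbT; last exact: cross_0.
    apply/negP => /eqP c0; move: fx1; rewrite functional_dot /dot big1 ?c0 ?ltxx // => i _.
    have := fic i; rewrite -c0 normr_le0 => /eqP e; by rewrite mxE e mul0r.
  have fi i : `|f (delta_mx 0 i)| = c.
    apply/eqP; rewrite eq_le fic /= leNgt; apply/negP => lt_c.
    have xi0 x : F x -> x 0 i = 0.
      rewrite eF => -[/cross_polytopeP Qx fx].
      apply/eqP; rewrite -normr_le0 leNgt; apply/negP => xi.
      have : c < c.
        rewrite -{1}fx functional_dot /dot; apply: le_lt_trans (ler_norm _) _.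
        apply: le_lt_trans (ler_norm_sum _ _ _) _.
        apply: (@lt_le_trans _ _ (\sum_j c * `|x 0 j|)); last first.
          by rewrite -mulr_sumr ler_piMr // ltW.
        rewrite (bigD1 i) //= [X in _ < X](bigD1 i) //=; apply: ltr_leD.
          by rewrite normrM mxE ltr_pM2r.
        by apply: ler_sum => j _; rewrite normrM mxE ler_wpM2r.
      by rewrite ltxx.
    have [|l hl] := hF [the {linear _ -> _} of dot (delta_mx 0 i)].
      by move=> x y Fx Fy; rewrite /= !(dotC (delta_mx 0 i)) !dot_delta !xi0.
    have hj j : (j == i)%:R = l * f (delta_mx 0 j).
      have := hl _ _ (cross_vertex_in (j, false)) cross_0.
      rewrite !combineE /cross_vertex /sign /= expr0 !scale1r !linear0 mulr0 subr0.
      by rewrite dot_delta mxE eqxx /= => /eqP; rewrite subr_eq0 => /eqP.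
    have l0 : l != 0.
      by apply/negP => /eqP l0; have /eqP := hj i; rewrite l0 mul0r eqxx oner_eq0.
    have : f x0 = 0.
      rewrite functional_dot /dot big1 // => j _; rewrite mxE.
      case: (eqVneq j i) => [->|nji]; first by rewrite (xi0 _ Fx0) mulr0.
      have /esym/eqP := hj j; rewrite (negPf nji) mulf_eq0 (negPf l0) /= => /eqP ->.
      by rewrite mul0r.
    by move=> f0; move: c0; rewrite -fx0 f0 ltxx.
  pose s := [ffun i => f (delta_mx 0 i) < 0].
  exists s => //.
  have fE x : f x = c * dot (sign_vec s) x.
    rewrite functional_dot /dot mulr_sumr; apply: eq_bigr => i _.
    rewrite !mxE ffunE -[X in X * _]mul1r -(signK (f (delta_mx 0 i) < 0)).
    by rewrite -[X in X * _]mulrA sign_abs fi mulrA [c * _]mulrC.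
  rewrite eF; apply/seteqP; split => x [Qx]; rewrite ?fE => e; split=> //.
    by rewrite fE e mulr1.
  by apply: (mulfI (lt0r_neq0 c0)); rewrite e mulr1.
have Qi i : cross_facet s (cross_vertex (i, s i)).
  split; first exact: cross_vertex_in.
  by rewrite dotC dot_sign_delta mxE signK.
apply: (@facet_intro _ _ _ [the {linear _ -> _} of dot (sign_vec s)] 1
  (cross_vertex (Ordinal d0, s (Ordinal d0)))) => //=.
- move=> x /cross_polytopeP; apply: le_trans; apply: ler_sum => i _.
  by apply: le_trans (ler_norm _) _; rewrite normrM mxE normr_signb mul1r.
- exact: cross_vertex_in.
- by case: (Qi (Ordinal d0)).
- by exists 0; [exact: cross_0|rewrite linear0 eq_sym oner_eq0].
move=> g gF; pose k := g (cross_vertex (Ordinal d0, s (Ordinal d0))).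
exists k => x y Px Py.
suff gx z : combine g [the {linear _ -> _} of dot (sign_vec s)] k z = 0 by rewrite !gx.
have gi i : g (delta_mx 0 i) = k * sign (s i).
  rewrite /k (gF _ _ (Qi _) (Qi i)) /cross_vertex functionalZ /=.
  by rewrite mulrC mulrA signK mul1r.
rewrite combineE /= functional_dot /dot mulr_sumr -sumrB big1 // => i _.
by rewrite !mxE gi mulrA subrr.
Qed.

Lemma cross_facet_inj : injective cross_facet.
Proof.
move=> s t e; apply/ffunP => i.
have : cross_facet s (cross_vertex (i, s i)).
  split; first exact: cross_vertex_in.
  by rewrite dotC dot_sign_delta mxE signK.
rewrite e => -[_]; rewrite dotC dot_sign_delta mxE /= => h.
by apply: (@sign_inj R); rewrite -[LHS]mulr1 -(signK (t i)) mulrA h mul1r.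
Qed.

Lemma num_facets_cross : (0 < d)%N -> num_facets (cross_polytope R d) = (2 ^ d)%N.
Proof.
move=> d0; rewrite /num_facets facets_cross //.
by rewrite (card_fset_set_range cross_facet_inj) card_ffun card_bool card_ord.
Qed.

Lemma aff_dim_cross : aff_dim (cross_polytope R d) = d.
Proof.
apply: aff_dim_full => [|i]; first exact: cross_0.
by have := cross_vertex_in (i, false); rewrite /cross_vertex /sign /= expr0 scale1r.
Qed.

Lemma aff_dim_cube : aff_dim (cube R d) = d.
Proof.
apply: aff_dim_full => [|i]; first exact: cube_0.
by apply/cubeP => j; rewrite !mxE; case: (_ && _); rewrite ?normr1 ?normr0 ?ler01.
Qed.

End CrossPolytope.

Section IsoCount.
Context {R : realType} {V : vectType R} (P : set V).
Hypothesis P0 : P !=set0.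

Lemma count_iso_cube : aff_isomorphic P (cube R (aff_dim P)) ->
  (num_vertices P * num_facets P = aff_dim P * 2 ^ (aff_dim P).+1)%N.
Proof.
move=> iso; have [f [b [g [c pq]]]] := aff_isomorphic_inverse iso P0 (esym aff_dim_cube).
rewrite (num_vertices_affine_pair pq) ?num_vertices_cube; last first.
  by rewrite vertices_cube; apply/finite_image/finite_finset.
rewrite (num_facets_affine_pair pq) ?num_facets_cube; last first.
  by rewrite facets_cube; apply/finite_image/finite_finset.
by rewrite mulnCA expnSr.
Qed.

Lemma count_iso_cross : aff_isomorphic P (cross_polytope R (aff_dim P)) ->
  (num_vertices P * num_facets P = aff_dim P * 2 ^ (aff_dim P).+1)%N.
Proof.
have [d0|d0] := posnP (aff_dim P).
  move=> _; rewrite d0 mul0n /num_facets (_ : facets P = set0) ?fset_set0 ?cardfs0 ?muln0 //.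
  by apply/seteqP; split => // F [_ _]; rewrite d0.
move=> iso; have [f [b [g [c pq]]]] := aff_isomorphic_inverse iso P0 (esym aff_dim_cross).
rewrite (num_vertices_affine_pair pq) ?num_vertices_cross //; last first.
  by rewrite vertices_cross //; apply/finite_image/finite_finset.
rewrite (num_facets_affine_pair pq) ?num_facets_cross //; last first.
  by rewrite facets_cross //; apply/finite_image/finite_finset.
by rewrite -mulnA expnS.
Qed.
End IsoCount.

(** * Facets of a 2-level base polytope *)
Section ConstantOnHulls.
Context {R : realType} {V : vectType R}.

Lemma conv_hull_const (S : set V) (g : {linear V -> R^o}) k :
  (forall x, S x -> g x = k) -> forall x, conv_hull S x -> g x = k.
Proof.
move=> gk _ [n [a [x [Sx _ a1 ->]]]]; rewrite linear_sum -[k]mul1r -a1 mulr_suml.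
by apply: eq_bigr => i _; rewrite functionalZ gk.
Qed.

Lemma aff_hull_const (S : set V) (g : {linear V -> R^o}) k :
  (forall x, S x -> g x = k) -> forall x, aff_hull S x -> g x = k.
Proof.
move=> gk _ [n [a [x [Sx a1 ->]]]]; rewrite linear_sum -[k]mul1r -a1 mulr_suml.
by apply: eq_bigr => i _; rewrite functionalZ gk.
Qed.

End ConstantOnHulls.

Section BasePolytope.
Import mathcomp.boot.fintype mathcomp.boot.finset.
Local Open Scope classical_set_scope.
Local Open Scope ring_scope.
Context {R : realType} {E : finType} (M : matroid E).
Implicit Types (A B C T U : {set E}) (e x y : E) (f g : {linear {ffun E -> R^o} -> R^o}).
Let P := base_polytope R M.

Definition weight_sum (w : E -> R) (z : {ffun E -> R^o}) : R^o := \sum_e w e * z e.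

Lemma weight_sum_linear w : linear (weight_sum w).
Proof.
move=> t y z; rewrite /weight_sum /GRing.scale /= mulr_sumr -big_split /=.
by apply: eq_bigr => e _; rewrite !ffunE /GRing.scale /=; ring.
Qed.
HB.instance Definition _ w := GRing.isLinear.Build R {ffun E -> R^o} R^o *:%R
  (weight_sum w) (weight_sum_linear w).

Definition unit_fun e : {ffun E -> R^o} := [ffun e' => (e' == e)%:R].

Definition weights f e : R := f (unit_fun e).

Lemma functional_weight_sum f z : f z = weight_sum (weights f) z.
Proof.
have {1}-> : z = \sum_e (z e) *: unit_fun e.
  apply/ffunP => e; rewrite sum_ffunE (bigD1 e) //= big1 ?addr0 => [|e' ne].
    by rewrite !ffunE eqxx /GRing.scale /= mulr1.
  by rewrite !ffunE eq_sym (negPf ne) /GRing.scale /= mulr0.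
by rewrite linear_sum; apply: eq_bigr => e _; rewrite functionalZ mulrC.
Qed.

Lemma weight_sum_char_vec w B : weight_sum w (char_vec R B) = \sum_(e in B) w e.
Proof.
rewrite /weight_sum [RHS]big_mkcond; apply: eq_bigr => e _.
by rewrite ffunE; case: (e \in B); rewrite ?mulr1 ?mulr0.
Qed.

Definition sum_on A := weight_sum (fun e => (e \in A)%:R).
HB.instance Definition _ A := GRing.isLinear.Build R {ffun E -> R^o} R^o *:%R
  (sum_on A) (weight_sum_linear _).

Lemma sum_on_char_vec A B : sum_on A (char_vec R B) = #|A :&: B|%:R.
Proof.
rewrite /sum_on weight_sum_char_vec -natr_sum; congr _%:R.
rewrite -sum1_card [RHS](eq_bigl (fun e => (e \in B) && (e \in A))) ?big_mkcondr // => e.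
by rewrite inE andbC.
Qed.

Lemma sum_onE A z : sum_on A z = \sum_(e in A) z e.
Proof.
rewrite /sum_on /weight_sum [RHS]big_mkcond; apply: eq_bigr => e _.
by case: (e \in A); rewrite ?mul1r ?mul0r.
Qed.

Lemma char_vec_inj : injective (@char_vec R E).
Proof.
move=> A B /ffunP eAB; apply/setP => e; have := eAB e; rewrite !ffunE.
by case: (e \in A); case: (e \in B) => // /eqP; rewrite ?oner_eq0 // eq_sym oner_eq0.
Qed.

Lemma char_vec_in B : B \in bases M -> P (char_vec R B).
Proof. by move=> BM; apply: sub_conv_hull; exists B. Qed.

Lemma base_polytope_neq0 : P !=set0.
Proof. by have /set0Pn[B BM] := bases_neq0 M; exists (char_vec R B); exact: char_vec_in. Qed.

Lemma vertices_base_polytope :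
  vertices P = [set char_vec R B | B in [set B | B \in bases M]].
Proof.
apply: vertices_conv_hull => _ [B BM <-]; exists [the {linear _ -> _} of sum_on B].
move=> _ [B' B'M <-] nB; rewrite /= !sum_on_char_vec ltr_nat; apply: proper_card.
rewrite setIid properEneq subsetIl andbT; apply: contra_notN nB => /eqP/setIidPl sB.
congr char_vec; apply/esym/eqP.
by rewrite eqEcard sB (card_basis B'M BM) leqnn.
Qed.

Lemma num_vertices_base_polytope : num_vertices P = #|bases M|.
Proof.
rewrite /num_vertices vertices_base_polytope.
by apply: card_fset_set_image; apply: in2W; exact: char_vec_inj.
Qed.

Lemma constant_on_basesP g :
  (forall B1 B2, B1 \in bases M -> B2 \in bases M -> g (char_vec R B1) = g (char_vec R B2)) ->
  constant_on g P.
Proof.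
have /set0Pn[B0 B0M] := bases_neq0 M => gB.
have gP z : P z -> g z = g (char_vec R B0).
  by apply: conv_hull_const => _ [B BM <-]; exact: gB.
by move=> y z Py Pz; rewrite !gP.
Qed.

Lemma functional_exchange f B x y : x \in B -> y \notin B ->
  f (char_vec R (y |: (B :\ x))) + weights f x = f (char_vec R B) + weights f y.
Proof.
move=> xB yB.
have fE D : f (char_vec R D) = \sum_(e in D) weights f e.
  by rewrite functional_weight_sum weight_sum_char_vec.
have e1 : \sum_(e in y |: B :\ x) weights f e = weights f y + \sum_(e in B :\ x) weights f e.
  by rewrite big_setU1 //= !inE (negPf yB) andbF.
have e2 : \sum_(e in B) weights f e = weights f x + \sum_(e in B :\ x) weights f e.
  exact: big_setD1.
rewrite !fE e1 e2; move: (\sum_(e in _) _) (weights f x) (weights f y) => s a b.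
by rewrite addrAC [RHS]addrAC [b + a]addrC.
Qed.

(** So only linear combinations of the sums over components are constant on P,
    which is why the dimension of P is #|E| minus the number of components. *)
Lemma constant_on_component f C : constant_on f P -> C \in components M ->
  {in C &, forall x y, weights f x = weights f y}.
Proof.
move=> fP; apply: exchange_constant_component => B x y BM xB yB B'M.
have := functional_exchange f xB yB.
by rewrite (fP _ _ (char_vec_in B'M) (char_vec_in BM)) => /addrI.
Qed.

Lemma sum_on_weights A e : weights [the {linear _ -> _} of sum_on A] e = (e \in A)%:R.
Proof.
rewrite /weights /= sum_onE; case: (boolP (e \in A)) => eA.
  rewrite (bigD1 e) //= big1 ?addr0 ?ffunE ?eqxx // => e' /andP[_ /negPf ne].
  by rewrite ffunE ne.
rewrite big1 // => e' e'A; rewrite ffunE; case: eqP => // ee.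
by rewrite -ee e'A in eA.
Qed.

Lemma combine_weights f g l e : weights (combine g f l) e = weights g e - l * weights f e.
Proof. exact: combineE. Qed.

Section Facet.
Variables (F : set {ffun E -> R^o}).
Hypothesis facetF : facets P F.
Hypothesis two_levelP : two_level P.

(** The weights of a facet functional have an upper level set T that is not a
    separator; A is its trace on a component.  Connectedness of A and of its
    contraction follow from constF: a set U that violates them has constant trace
    on the bases of F, but its indicator is not affine in that of A on C. *)
Lemma facet_is_flacet : exists2 C, C \in components M &
  exists2 A, A \in flacets (rank M) C & F = [set z | P z /\ sum_on A z = (rank M A)%:R].
Proof.
have [f [c [fc eF [z0 Fz0] [z1 Pz1 fz1] hF]]] := facet_functional facetF.
have [Pz0 fz0] : P z0 /\ f z0 = c by move: Fz0; rewrite eF.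
have fcB B : B \in bases M -> f (char_vec R B) <= c by move=> BM; apply/fc/char_vec_in.
have onF g k : (forall B, B \in bases M -> f (char_vec R B) = c -> g (char_vec R B) = k) ->
    forall z, F z -> g z = k.
  move=> gk z; rewrite eF => -[Pz fz].
  apply: (conv_hull_const _ (conv_hull_argmax _ Pz fz)) => [_ [[B BM <-] fB]|_ [B BM <-]].
    exact: gk.
  exact: fcB.
have optimal B T : B \in bases M -> f (char_vec R B) = c ->
    (forall x y, x \notin T -> y \in T -> weights f x < weights f y) -> #|T :&: B| = rank M T.
  move=> BM fB upT; apply/eqP; rewrite eqn_leq rank_ge //= leqNgt; apply/negP.
  move=> /(rank_improve BM)[x [y [/setDP[xB xT] /setDP[yT yB] B'M]]].
  have := functional_exchange f xB yB; have := fcB _ B'M; have := upT _ _ xT yT.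
  by rewrite fB; lra.
(* If all upper level sets were separators, exchanged elements would have equal
   weights, and f would be constant on P. *)
have [T upT nsT] : exists2 T : {set E},
    (forall x y, x \notin T -> y \in T -> weights f x < weights f y) & ~~ separator M T.
  apply: contrapT => nT.
  have sepT t : separator M [set e | t <= weights f e]%SET.
    apply/negPn/negP => ns; apply: nT; exists [set e | t <= weights f e]%SET => // x y.
    by rewrite !inE -ltNge; exact: lt_le_trans.
  have /constant_on_basesP fP : forall B1 B2, B1 \in bases M -> B2 \in bases M ->
      f (char_vec R B1) = f (char_vec R B2).
    apply: (@exchange_invariant _ M R (fun B => f (char_vec R B))) => B x y BM xB yB B'M.
    have memT t : (t <= weights f x) = (t <= weights f y).
      have := card_exchange [set e | t <= weights f e]%SET xB yB.
      rewrite (separator_card (sepT t) BM) (separator_card (sepT t) B'M) !inE.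
      by do 2 case: (t <= _) => //=; clear; lia.
    have exy : weights f x = weights f y.
      by apply/eqP; rewrite eq_le -memT lexx memT lexx.
    by have := functional_exchange f xB yB; rewrite exy => /addIr.
  by move: fz1; rewrite -fz0 (fP z1 z0) // ltxx.
have [C CP nsA] : exists2 C : {set E}, C \in components M & ~~ separator M (T :&: C).
  apply: contrapT => nC; move/negP: nsT; apply; apply: separatorP => B1 B2 B1M B2M.
  have cardT B : #|T :&: B| = (\sum_(C in components M) #|(T :&: C) :&: B|)%N.
    by rewrite (card_sum_components M); apply: eq_bigr => C _; rewrite setIAC.
  rewrite !cardT; apply: eq_bigr => C CP.
  have sTC : separator M (T :&: C).
    by apply/negPn/negP => ns; apply: nC; exists C.
  by rewrite !(separator_card sTC).
set A := T :&: C in nsA.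
have sAC : A \subset C by exact: subsetIr.
have optA B : B \in bases M -> f (char_vec R B) = c -> #|A :&: B| = rank M A.
  move=> BM fB; have := optimal B T BM fB upT.
  have := rank_separator T (component_separator CP).
  have := rank_ge (T :&: C) BM; have := rank_ge (T :\: C) BM.
  have := cardsID C (T :&: B); rewrite setIAC setIDAC -/A; clear; lia.
have A0 : A != set0.
  by apply: contraNneq nsA => ->; rewrite /separator rank0 setC0.
have pA : A \proper C.
  rewrite properEneq sAC andbT; apply: contraNneq nsA => ->.
  exact: component_separator.
have sumA z : F z -> sum_on A z = (rank M A)%:R.
  by apply: (onF [the {linear _ -> _} of sum_on A]) => B BM fB /=; rewrite sum_on_char_vec optA.
have [|l hl] := hF [the {linear _ -> _} of sum_on A].
  by move=> y z Fy Fz; rewrite /= !sumA.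
have l0 : l != 0.
  apply: contraNneq nsA => l0; apply: separatorP => B1 B2 B1M B2M.
  have := hl _ _ (char_vec_in B1M) (char_vec_in B2M).
  by rewrite !combineE l0 !mul0r !subr0 /= !sum_on_char_vec => /eqP; rewrite eqr_nat => /eqP.
have FE : F = [set z | P z /\ sum_on A z = (rank M A)%:R].
  apply/seteqP; split => z; first by move=> Fz; split; [move: Fz; rewrite eF => -[]|exact: sumA].
  move=> [Pz Az]; rewrite eF; split=> //.
  have := hl z z0 Pz Pz0; rewrite !combineE /= Az (sumA _ Fz0) => /addrI/oppr_inj.
  by rewrite fz0 => /(mulfI l0).
have onFE B : B \in bases M -> (f (char_vec R B) == c) = (#|A :&: B| == rank M A).
  move=> BM; apply/eqP/eqP => [/(optA _ BM) //|cAB].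
  have : F (char_vec R B) by rewrite FE; split; [exact: char_vec_in|rewrite sum_on_char_vec cAB].
  by rewrite eF => -[].
(* Both sum_on X and sum_on A are, on P, affine functions of f, the latter with
   nonzero slope l; eliminating f leaves a functional that is constant on P. *)
have constF (X : {set E}) :
    (exists k, forall B, B \in bases M -> f (char_vec R B) = c -> #|X :&: B| = k) ->
    exists nu : R, {in C &, forall x y,
      (x \in X)%:R - nu * (x \in A)%:R = (y \in X)%:R - nu * (y \in A)%:R}.
  move=> [k hk]; have [|m hm] := hF [the {linear _ -> _} of sum_on X].
    have sumX z : F z -> sum_on X z = k%:R.
      by apply: (onF [the {linear _ -> _} of sum_on X]) => B BM fB /=; rewrite sum_on_char_vec hk.
    by move=> y z Fy Fz; rewrite /= !sumX.
  exists (m / l) => x y xC yC.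
  have : constant_on (combine [the {linear _ -> _} of sum_on X]
      [the {linear _ -> _} of sum_on A] (m / l)) P.
    move=> y' z' Py Pz; have := hl _ _ Py Pz; have := hm _ _ Py Pz.
    rewrite !combineE /=.
    move: (sum_on X y') (sum_on X z') (sum_on A y') (sum_on A z') => a1 a2 a3 a4 e1 e2.
    have -> : a1 = a2 - m * f z' + m * f y' by rewrite -e1 subrK.
    have -> : a3 = a4 - l * f z' + l * f y' by rewrite -e2 subrK.
    by field.
  move/constant_on_component/(_ CP) => /(_ x y xC yC).
  by rewrite !combine_weights !sum_on_weights.
have [B1 B1M ltB1] : exists2 B1, B1 \in bases M & (#|A :&: B1| < rank M A)%N.
  apply: contrapT => nB; move/negP: nsA; apply; apply: separatorP => B1 B2 B1M B2M.
  have eqr B : B \in bases M -> #|A :&: B| = rank M A.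
    move=> BM; apply/eqP; rewrite eqn_leq rank_ge //= leqNgt; apply/negP => lt.
    by apply: nB; exists B.
  by rewrite !eqr.
have [v hv] := two_levelP facetF.
(* Off F, all vertices lie in one translate of the affine hull of F, so their
   traces on A have one common size. *)
have offF B : B \in bases M -> (#|A :&: B| < rank M A)%N -> #|A :&: B| = #|A :&: B1|.
  have val B' : B' \in bases M -> (#|A :&: B'| < rank M A)%N ->
      #|A :&: B'|%:R = (rank M A)%:R + sum_on A v.
    move=> B'M lt; have /hv[y yF] : (vertices P `\` F) (char_vec R B').
      split; first by rewrite vertices_base_polytope; exists B'.
      rewrite FE => -[_]; rewrite sum_on_char_vec => /eqP; rewrite eqr_nat => /eqP e.
      by rewrite e ltnn in lt.
    rewrite -sum_on_char_vec => <-.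
    rewrite (linearD [the {linear _ -> _} of sum_on A]) /=.
    by rewrite (aff_hull_const (g := [the {linear _ -> _} of sum_on A]) sumA yF).
  by move=> BM lt; apply/eqP; rewrite -(eqr_nat R) !val.
(* An exchange from B1 into A gains exactly one element, and must land in F. *)
have rA : rank M A = #|A :&: B1|.+1.
  have [x [y [/setDP[xB xA] /setDP[yA yB] B2M]]] := rank_improve B1M ltB1.
  have := card_exchange A xB yB; rewrite (negPf xA) yA addn0 addn1 => c2.
  apply/eqP; rewrite eqn_leq ltB1 andbT leqNgt; apply/negP => lt2.
  by have := offF _ B2M; rewrite c2 lt2 => /(_ isT)/eqP; rewrite eqn_leq ltnn.
have tsA : two_separation (rank M) C A.
  rewrite /two_separation A0 pA /= eqn_leq (component_connected CP A0 pA) andbT.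
  have [B2 B2M rCA] := rank_attained M (C :\: A).
  have := cardsID A (C :&: B2); rewrite -setIDAC rCA setIAC (setIidPr sAC).
  have := component_card CP B2M; have := offF _ B2M; have := rank_ge A B2M.
  by rewrite rA; clear; lia.
exists C => //; exists A => //; rewrite inE /flacet tsA /=; apply/andP; split.
  apply/forallP => U; apply/implyP => /andP[/set0Pn[x xU] /properP[sUA [y yA yU]]].
  rewrite ltnNge; apply/negP => le_r.
  have [|nu hnu] := constF U.
    exists (rank M U) => B BM fB; have := optA B BM fB.
    have := cardsID U (A :&: B); rewrite setIAC (setIidPr sUA) -setIDAC.
    by move: le_r; have := rank_ge U BM; have := rank_ge (A :\: U) BM; clear; lia.
  have := hnu x y (subsetP sAC _ (subsetP sUA _ xU)) (subsetP sAC _ yA).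
  by rewrite xU (negPf yU) yA (subsetP sUA _ xU) => /addIr/eqP; rewrite oner_eq0.
apply/forallP => Y; apply/implyP => /andP[/set0Pn[x xY] /properP[sY [y yCA yY]]].
rewrite ltnNge; apply/negP => le_r.
have [|nu hnu] := constF Y.
  exists (rank M (A :|: Y) - rank M A)%N => B BM fB; have := optA B BM fB.
  have sYC : Y \subset C := subset_trans sY (subsetDl _ _).
  have := cardsID Y (C :&: B); rewrite setIAC (setIidPr sYC) -setIDAC.
  have := cardsID A ((A :|: Y) :&: B); rewrite setIAC -setIDAC.
  have -> : (A :|: Y) :&: A = A by apply/setIidPr/subsetUl.
  have -> : (A :|: Y) :\: A = Y.
    rewrite setDUl setDv set0U; apply/setDidPl.
    by move: sY; rewrite subsetD => /andP[].
  have := component_card CP BM.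
  by move: le_r; have := rank_ge (A :|: Y) BM; have := rank_ge (C :\: Y) BM; clear; lia.
have /setDP[xC xA] := subsetP sY _ xY; have /setDP[yC yA] := yCA.
have := hnu x y xC yC.
by rewrite xY (negPf yY) (negPf xA) (negPf yA) => /addIr/eqP; rewrite oner_eq0.
Qed.

End Facet.
End BasePolytope.

(** * The bound and the tight cases *)
Section Counting.
Import mathcomp.boot.fintype mathcomp.boot.finset.
Local Open Scope classical_set_scope.
Local Open Scope ring_scope.
Context {R : realType} {E : finType} (M : matroid E).
Implicit Types (A B C : {set E}).
Let P := base_polytope R M.

Lemma card_flacets_component_le C : C \in components M ->
  (#|flacets (rank M) C| <= 3 * #|C| - 4)%N.
Proof.
move=> CP; have [C1|C1] := leqP #|C| 1; first by rewrite flacets_eq0 // cards0.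
apply: card_flacets_le => //.
- exact: rank_submod.
- exact: rank_mono.
- by move=> x; apply: leq_trans (rank_le_card _ _) _; rewrite cards1.
- by move=> A; exact: component_connected.
Qed.

Lemma num_facets_le : two_level P ->
  (num_facets P <= \sum_(C in components M) (3 * #|C| - 4))%N.
Proof.
move=> P2; pose Fl := (\bigcup_(C in components M) flacets (rank M) C)%SET.
apply: (@leq_trans #|Fl|).
  apply: (@card_fset_set_le _ _ Fl (fun A => [set z | P z /\ sum_on A z = (rank M A)%:R])).
  move=> F fF; have [C CP [A Afl ->]] := facet_is_flacet fF P2.
  by exists A => //=; apply/bigcupP; exists C.
apply: (@leq_trans (\sum_(C in components M) #|flacets (rank M) C|)).
  rewrite /Fl; elim/big_rec2: _ => [|C m X _ le]; first by rewrite cards0.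
  by apply: leq_trans (leq_card_setU _ _) _; rewrite leq_add2l.
by apply: leq_sum => C; exact: card_flacets_component_le.
Qed.

Lemma component_card_gt0 C : C \in components M -> (0 < #|C|)%N.
Proof. by move=> CP; rewrite card_gt0; exact: component_neq0 CP. Qed.

Lemma component_bin_le C : C \in components M -> ('C(#|C|, rank M C) <= 2 ^ #|C|.-1)%N.
Proof.
by move=> CP; have := component_card_gt0 CP; case: #|C| => // n _; exact: bin_le_exp2.
Qed.

Lemma component_bin_facet_le C : C \in components M ->
  ('C(#|C|, rank M C) * (3 * #|C| - 4) <= #|C|.-1 * 2 ^ #|C|.-1.+1)%N.
Proof.
move=> CP; have n0 := component_card_gt0 CP.
by rewrite prednK //; case: (bin_facet_bound (rank M C) n0).
Qed.

Let d := (\sum_(C in components M) #|C|.-1)%N.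

Lemma bases_facets_le : two_level P -> (#|bases M| * num_facets P <= d * 2 ^ d.+1)%N.
Proof.
move=> P2; apply: leq_trans (leq_mul (card_bases_le M) (num_facets_le P2)) _.
apply: prod_sum_le; [exact: component_bin_le|exact: component_bin_facet_le].
Qed.

(** If all components have at most two elements, there are at most 2 d facets, so
    2 ^ d vertices are needed.  The second case is the octahedron. *)
Lemma bases_facets_eq : two_level P -> (#|bases M| * num_facets P = d * 2 ^ d.+1)%N ->
  (2 ^ d <= #|bases M|)%N \/
  exists2 C, C \in components M &
   [/\ #|C| = 4, rank M C = 2, #|bases M| = 6 &
       forall C', C' \in components M -> C' != C -> #|C'| = 1].
Proof.
move=> P2 eq_vf.
have [small|] := boolP [forall C in components M, #|C| <= 2]%N.
  left; have [d0|d0] := posnP d; first by rewrite d0 card_gt0 bases_neq0.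
  have f2 : (num_facets P <= 2 * d)%N.
    apply: leq_trans (num_facets_le P2) _; rewrite /d big_distrr; apply: leq_sum => C CP.
    have := forall_inP small C CP; have := component_card_gt0 CP.
    by case: #|C| => [|[|[|n]]].
  have := leq_mul (leqnn #|bases M|) f2.
  rewrite eq_vf expnS [(2 * d)%N]mulnC mulnA [X in (_ <= X)%N]mulnC.
  by rewrite leq_pmul2l ?muln_gt0 ?d0.
rewrite negb_forall_in => /existsP[C /andP[CP]]; rewrite -ltnNge => C3; right.
have eq_ps : ((\prod_(C in components M) 'C(#|C|, rank M C)) *
    (\sum_(C in components M) (3 * #|C| - 4)) = d * 2 ^ d.+1)%N.
  apply/eqP; rewrite eqn_leq -{2}eq_vf; apply/andP; split.
    by apply: prod_sum_le; [exact: component_bin_le|exact: component_bin_facet_le].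
  by apply: leq_mul; [exact: card_bases_le|exact: num_facets_le].
have others C' : C' \in components M -> C' != C -> #|C'| = 1.
  move=> C'P nC; have := component_card_gt0 C'P; case n: #|C'| => [|[|k]] // _.
  have := @prod_sum_eq _ _ _ _ _ component_bin_le component_bin_facet_le C' C eq_ps C'P CP nC.
  by rewrite n => /(_ isT) e; have := bin_lt_exp2 (rank M C) C3; rewrite e ltnn.
have dC : d = #|C|.-1.
  by rewrite /d (bigD1 C) //= big1 ?addn0 // => C' /andP[C'P nC]; rewrite others.
have v_le : (#|bases M| <= 'C(#|C|, rank M C))%N.
  apply: leq_trans (card_bases_le M) _; rewrite (bigD1 C) //= -[X in (_ <= X)%N]muln1 leq_mul2l.
  apply/orP; right.
  apply: (@leq_trans (\prod_(C' in components M | C' != C) 1)%N); last by rewrite big1.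
  by apply: leq_prod => C' /andP[C'P nC]; rewrite others //; case: (rank M C') => [|[|k]].
have f_le : (num_facets P <= 3 * #|C| - 4)%N.
  apply: leq_trans (num_facets_le P2) _; rewrite (bigD1 C) //= [X in (_ + X)%N]big1 ?addn0 //.
  by move=> C' /andP[C'P nC]; rewrite others.
have C0 := component_card_gt0 CP.
have [le eq] := bin_facet_bound (rank M C) C0.
have eq_vf' : (#|bases M| * num_facets P = #|C|.-1 * 2 ^ #|C|)%N.
  by rewrite eq_vf dC prednK.
have tight : ('C(#|C|, rank M C) * (3 * #|C| - 4) == #|C|.-1 * 2 ^ #|C|)%N.
  by rewrite eqn_leq le /= -eq_vf' leq_mul.
have {eq} : [|| #|C| == 1, (#|C| == 2) && (rank M C == 1) | (#|C| == 4) && (rank M C == 2)]%N.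
  by rewrite -eq.
case/or3P => [/eqP c1|/andP[/eqP c2 _]|/andP[/eqP c4 /eqP r2]].
- by rewrite c1 in C3.
- by rewrite c2 in C3.
exists C => //; split=> //; apply/eqP; rewrite eqn_leq; move: v_le f_le eq_vf'; rewrite c4 r2.
rewrite (_ : 'C(4, 2) = 6)%N // (_ : (3 * 4 - 4) = 8)%N // (_ : (4.-1 * 2 ^ 4) = 48)%N //.
by move: #|bases M| (num_facets P) => v f; clear; nia.
Qed.

End Counting.

(** * The dimension of a base polytope *)
Section Dimension.
Import mathcomp.boot.fintype mathcomp.boot.finset.
Local Open Scope classical_set_scope.
Local Open Scope ring_scope.
Context {R : realType} {E : finType} (M : matroid E).
Implicit Types (A B C : {set E}).
Let P := base_polytope R M.
Let K := aff_direction P.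

(** A separating functional for a vector outside the direction is constant on P,
    so its weights are constant on components, and it kills all vectors that sum
    to 0 over each component. *)
Lemma mem_direction_base_polytope (u : {ffun E -> R^o}) :
  reflect (forall C, C \in components M -> \sum_(e in C) u e = 0) (u \in K).
Proof.
apply: (iffP idP) => [uK C CP|uC]; have [z0 Pz0] := @base_polytope_neq0 R E M.
  have cC : constant_on [the {linear _ -> _} of sum_on C] P.
    apply: constant_on_basesP => B1 B2 B1M B2M /=.
    by rewrite !sum_on_char_vec !(component_card CP).
  by have := proj1 (constant_onP _ Pz0) cC u uK; rewrite /= sum_onE.
apply/negPn/negP => uK; have [g g0 /eqP gu] := separating_functional uK; apply: gu.
have cg := proj2 (constant_onP g Pz0) g0.
rewrite functional_weight_sum /weight_sum -(eq_bigl _ _ (@in_setT E)).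
rewrite (set_partition_big _ (components_partition M)) /=; apply: big1 => C CP.
have /set0Pn[x xC] := component_neq0 CP.
under eq_bigr => y yC do rewrite -(constant_on_component cg CP xC yC).
by rewrite -mulr_sumr uC // mulr0.
Qed.

(** Leaving out one element per component gives coordinates on the affine hull,
    because the sum over each component is fixed. *)
Definition representatives := transversal (components M) [set: E].
Definition coordinates := ~: representatives.
Definition representative (e0 : E) C := transversal_repr e0 representatives C.

Let trX : is_transversal representatives (components M) [set: E].
Proof. exact/transversalP/components_partition. Qed.

Lemma representative_in e0 C : C \in components M -> representative e0 C \in C.
Proof. exact: repr_mem_pblock trX _ _. Qed.

Lemma component_coordinates e0 C e : C \in components M -> e \in C ->
  (e \in coordinates) = (e != representative e0 C).
Proof.
move=> CP eC; rewrite inE; congr (~~ _); apply/idP/eqP => [eX|->].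
  have := pblockK trX e0 eX; have /and3P[_ tP _] := components_partition M.
  by rewrite (def_pblock tP CP eC) => <-.
exact: repr_mem_transversal trX _ _ CP.
Qed.

Lemma card_coordinates : #|coordinates| = (\sum_(C in components M) #|C|.-1)%N.
Proof.
rewrite sum_pred_card_components cardsCs setCK; congr (_ - _)%N.
exact: card_transversal trX.
Qed.

Lemma direction_coordinates_eq0 u :
  u \in K -> (forall e, e \in coordinates -> u e = 0) -> u = 0.
Proof.
move=> /mem_direction_base_polytope uC u0; apply/ffunP => e; rewrite ffunE.
have CP := mem_pblock_component M e; set C := pblock _ e in CP.
have eC : e \in C by rewrite mem_pblock cover_components inE.
have [|] := boolP (e \in coordinates); first exact: u0.
rewrite (component_coordinates e CP eC) negbK => /eqP er.
have := uC C CP; rewrite (bigD1 e) //= big1 ?addr0 // => e' /andP[e'C ne'].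
by apply: u0; rewrite (component_coordinates e CP e'C) -er.
Qed.

Definition coordinate_map (z : {ffun E -> R^o}) : 'rV[R]_#|coordinates| :=
  \row_i z (enum_val i).

Lemma coordinate_map_linear : linear coordinate_map.
Proof. by move=> t x y; apply/rowP => i; rewrite !mxE !ffunE. Qed.
HB.instance Definition _ := GRing.isLinear.Build R {ffun E -> R^o} 'rV[R]_#|coordinates| *:%R
  coordinate_map coordinate_map_linear.

Lemma coordinate_map_eq0 u : u \in K -> coordinate_map u = 0 -> u = 0.
Proof.
move=> uK /rowP u0; apply: direction_coordinates_eq0 => // e eD.
by have := u0 (enum_rank_in eD e); rewrite !mxE enum_rankK_in.
Qed.

(** The projection to the coordinates is injective on the direction, and it is
    onto: the unit vector at e is the image of e minus the representative of
    its component. *)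
Lemma aff_dim_base_polytope : aff_dim P = #|coordinates|.
Proof.
rewrite /aff_dim -/K; pose L := linfun coordinate_map.
have kerL : (K :&: lker L = 0)%VS.
  apply/eqP; rewrite -subv0; apply/subvP => u; rewrite memv_cap memv_ker lfunE memv0.
  by move=> /andP[uK /eqP u0]; apply/eqP/coordinate_map_eq0.
rewrite -(limg_dim_eq kerL).
suff /eqP -> : (L @: K)%VS == fullv by rewrite dimvf /dim /= mul1n.
rewrite eqEsubv subvf /=; apply/subvP => w _; rewrite (row_sum_delta w).
apply: memv_suml => i _; apply: memvZ; pose e := enum_val i.
have eD : e \in coordinates by exact: enum_valP.
pose r := representative e (pblock (components M) e).
have CP := mem_pblock_component M e.
have eC : e \in pblock (components M) e by rewrite mem_pblock cover_components inE.
have rC : r \in pblock (components M) e by exact: representative_in.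
have rD : r \notin coordinates by rewrite (component_coordinates e CP rC) eqxx.
apply/memv_imgP; exists (unit_fun (R := R) e - unit_fun r).
  apply/mem_direction_base_polytope => C C'P.
  under eq_bigr do rewrite !ffunE.
  have sumu x : \sum_(y in C) ((y == x)%:R : R) = (x \in C)%:R.
    have [xC|xC] := boolP (x \in C).
      by rewrite (bigD1 x) //= eqxx big1 ?addr0 // => y /andP[_ /negPf ->].
    by rewrite big1 // => y yC; case: eqP => // yx; rewrite -yx yC in xC.
  rewrite sumrB /= !sumu.
  by rewrite (component_atom CP (component_separator C'P) eC rC) subrr.
rewrite lfunE /=; apply/rowP => j; rewrite !mxE !ffunE eqxx /= [in RHS]/e (inj_eq enum_val_inj).
have /negPf -> : enum_val j != r by apply: contraNneq rD => <-; exact: enum_valP.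
by rewrite subr0.
Qed.

End Dimension.

(** * Recognising the cube and the octahedron *)
Section Isomorphisms.
Import mathcomp.boot.fintype mathcomp.boot.finset.
Local Open Scope classical_set_scope.
Local Open Scope ring_scope.
Context {R : realType} {E : finType} (M : matroid E).
Implicit Types (A B C : {set E}).
Let P := base_polytope R M.
Let K := aff_direction P.

(** An affine map that is injective on P and sends bases into a set of at most as
    many points is a bijection between the two, hence between their hulls. *)
Lemma isomorphic_by_counting (W : vectType R) (I : finType) (X : I -> W) (Q : set W)
    (f : {linear {ffun E -> R^o} -> W}) (b : W) :
  Q = conv_hull (range X) ->
  (forall u, u \in K -> f u = 0 -> u = 0) ->
  (forall B, B \in bases M -> exists i, f (char_vec R B) + b = X i) ->
  (#|I| <= #|bases M|)%N ->
  aff_isomorphic P Q.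
Proof.
move=> QE f_inj fX cI; pose phi z := f z + b.
have phi_inj z1 z2 : P z1 -> P z2 -> phi z1 = phi z2 -> z1 = z2.
  move=> Pz1 Pz2 /addIr e; apply/eqP; rewrite -subr_eq0; apply/eqP/f_inj.
    exact: aff_direction_mem.
  by rewrite linearB e subrr.
pose s1 := [seq phi (char_vec R B) | B <- enum (bases M)].
pose s2 := codom X.
have us1 : uniq s1.
  rewrite map_inj_in_uniq ?enum_uniq // => B1 B2; rewrite !mem_enum => B1M B2M.
  by move/phi_inj => /(_ (char_vec_in B1M) (char_vec_in B2M)); exact: char_vec_inj.
have s12 : {subset s1 <= s2}.
  move=> w /mapP[B]; rewrite mem_enum => /fX[i ei] ->.
  by rewrite /phi ei codom_f.
have [|_ s12E] := uniq_min_size us1 s12; first by rewrite size_codom size_map -cardE.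
have image : [set phi z | z in P] = Q.
  rewrite /phi /P /base_polytope conv_hull_image QE; congr conv_hull.
  apply/seteqP; split => [_ [_ [B BM <-] <-]|_ [i _ <-]].
    by have [i ->] := fX B BM; exists i.
  have : X i \in s1 by rewrite s12E codom_f.
  by move=> /mapP[B]; rewrite mem_enum => BM ->; exists (char_vec R B) => //; exists B.
exists f, b; split.
- by move=> z Pz; rewrite -image; exists z.
- by move=> z1 z2 /set_mem Pz1 /set_mem Pz2; exact: phi_inj.
- by move=> w; rewrite -image => -[z Pz <-]; exists z.
Qed.

Lemma isomorphic_cube :
  (2 ^ aff_dim P <= #|bases M|)%N -> aff_isomorphic P (cube R (aff_dim P)).
Proof.
rewrite aff_dim_base_polytope => v_ge.
pose f := [the {linear {ffun E -> R^o} -> 'rV[R]_#|coordinates M|} of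
  (2%:R *: linfun (@coordinate_map R E M))%VF : {ffun E -> R^o} -> 'rV[R]_#|coordinates M|].
have fE z : f z = 2%:R *: coordinate_map M z by rewrite /f /= scale_lfunE lfunE.
apply: (@isomorphic_by_counting _ _ (@sign_vec R _) _ f (const_mx (-1))).
- exact: cube_conv_hull.
- move=> u uK; rewrite fE => /eqP; rewrite scaler_eq0 pnatr_eq0 /= => /eqP.
  exact: coordinate_map_eq0.
- move=> B BM; exists [ffun i => enum_val i \notin B]; rewrite fE.
  apply/rowP => i; rewrite !mxE !ffunE /sign.
  by case: (_ \in B); rewrite /= ?expr0 ?expr1; ring.
- by rewrite card_ffun card_bool card_ord.
Qed.

(** Let c be the representative of C.  The map with i-th coordinate
    z c + z e_i - 1, where e_i runs over the three other elements of C, sends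
    the base trace {c, e_i} to the i-th unit vector and its complement in C to the
    opposite vector. *)
Lemma isomorphic_cross_polytope C : C \in components M ->
  #|C| = 4 -> rank M C = 2 -> #|bases M| = 6 ->
  (forall C', C' \in components M -> C' != C -> #|C'| = 1%N) ->
  aff_isomorphic P (cross_polytope R (aff_dim P)).
Proof.
move=> CP C4 rC v6 others.
have D3 : #|coordinates M| = 3%N.
  rewrite card_coordinates (bigD1 C) //= big1 ?addn0 ?C4 // => C' /andP[C'P nC].
  by rewrite others.
have /set0Pn[e0 e0C] := component_neq0 CP.
pose c := representative M e0 C.
have cC : c \in C by exact: representative_in.
have coordC : coordinates M = C :\ c.
  have cD : #|C :\ c| = 3%N by move: C4; rewrite (cardsD1 c) cC add1n => -[].
  apply/esym/eqP; rewrite eqEcard D3 cD andbT.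
  apply/subsetP => e /setD1P[ne eC].
  by rewrite (component_coordinates e0 CP eC).
rewrite aff_dim_base_polytope.
have eq0 (t : R) : t + (- t) *+ 3 = 0 -> t = 0.
  by rewrite -mulr_natr; lra.
pose f (z : {ffun E -> R^o}) : 'rV[R]_#|coordinates M| := \row_i (z c + z (enum_val i)).
have f_lin : linear f.
  by move=> t x y; apply/rowP => i; rewrite !mxE !ffunE mulrDr addrACA.
apply: (@isomorphic_by_counting _ _ (@cross_vertex R _) _ (linear_of f_lin) (const_mx (-1))).
- by rewrite cross_polytope_conv_hull ?D3.
- move=> u uK /rowP fu.
  have ue e : e \in coordinates M -> u e = - u c.
    move=> eD; have := fu (enum_rank_in eD e); rewrite !mxE enum_rankK_in // => h.
    by apply/eqP; rewrite -addr_eq0 addrC h.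
  have uc : u c = 0.
    have /mem_direction_base_polytope/(_ C CP) := uK.
    rewrite (big_setD1 c) //= -coordC (eq_bigr (fun=> - u c)) // sumr_const D3.
    exact: eq0.
  by apply: direction_coordinates_eq0 uK _ => e eD; rewrite ue // uc oppr0.
- move=> B BM; have cB : ((c \in B) + #|coordinates M :&: B| = 2)%N.
    have := component_card CP BM; rewrite rC (cardsD1 c) inE cC /= => cCB.
    by rewrite coordC setIDAC; exact: cCB.
  have [e [eD eP]] : exists e, e \in coordinates M /\
      forall e', e' \in coordinates M -> (e' == e) = ((e' \in B) == (c \in B)).
    have cDB := cardsID B (coordinates M); rewrite D3 in cDB.
    case cinB: (c \in B) cB => cB.
      have /cards1P[e eE] : #|coordinates M :&: B| == 1 by move: cB; rewrite add1n => -[->].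
      have : e \in coordinates M :&: B by rewrite eE inE.
      move=> /setIP[eD _]; exists e; split=> // e' e'D.
      by rewrite eqb_id -in_set1 -eE inE e'D.
    have /cards1P[e eE] : #|coordinates M :\: B| == 1.
      by apply/eqP; move: cB cDB; rewrite add0n => -> [].
    have : e \in coordinates M :\: B by rewrite eE inE.
    move=> /setDP[eD _]; exists e; split=> // e' e'D.
    by rewrite eqbF_neg -in_set1 -eE inE e'D andbT.
  exists (enum_rank_in eD e, c \notin B); apply/rowP => j.
  rewrite cross_vertexE !mxE !ffunE /= -(inj_eq enum_val_inj) enum_rankK_in //.
  rewrite eP ?enum_valP // /sign.
  by case: (c \in B); case: (enum_val j \in B); rewrite /= ?expr0 ?expr1; lra.
- by rewrite card_prod card_bool card_ord D3 v6.
Qed.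

Lemma base_polytope_count_le : two_level P ->
  (num_vertices P * num_facets P <= aff_dim P * 2 ^ (aff_dim P).+1)%N.
Proof.
move=> P2; rewrite num_vertices_base_polytope aff_dim_base_polytope card_coordinates.
exact: bases_facets_le P2.
Qed.

Lemma base_polytope_extremal : two_level P ->
  (num_vertices P * num_facets P)%N = (aff_dim P * 2 ^ (aff_dim P).+1)%N ->
  aff_isomorphic P (cube R (aff_dim P)) \/ aff_isomorphic P (cross_polytope R (aff_dim P)).
Proof.
move=> P2; rewrite num_vertices_base_polytope {1 2}aff_dim_base_polytope card_coordinates.
move=> /(bases_facets_eq P2)[v_ge|[C CP [C4 rC v6 others]]]; [left|right].
  by apply: isomorphic_cube; rewrite aff_dim_base_polytope card_coordinates.
exact: isomorphic_cross_polytope C4 rC v6 others.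
Qed.

End Isomorphisms.

Theorem lemma26 (R : realType) (E : finType) (M : matroid E)
    (P : set {ffun E -> R^o}) (d : nat) :
  P = base_polytope R M -> two_level P -> d = aff_dim P ->
  (num_vertices P * num_facets P <= d * 2 ^ d.+1)%N /\
  ((num_vertices P * num_facets P)%N = (d * 2 ^ d.+1)%N <->
   aff_isomorphic P (cube R d) \/ aff_isomorphic P (cross_polytope R d)).
Proof.
move=> -> P2 ->; split; first exact: base_polytope_count_le.
split; first exact: base_polytope_extremal.
by case; [apply: count_iso_cube|apply: count_iso_cross]; exact: base_polytope_neq0.
Qed.
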